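(* Let $n\ge m\ge 0$ be integers. Define the rational functions of $t$ \[ R_{n,m}(t)=(-1)^m\Bigl(t+\frac n2\Bigr)\frac{(t-n)_m}{m!}\,\frac{(t-2n+m)_{2n-m}}{(2n-m)!}\, \frac{(t+n+1)_n}{(t)_{n+1}}\,\frac{(t+n+1)_{2n-m}}{(t)_{2n-m+1}}\,\biggl(\frac{n!}{(t)_{n+1}}\biggr)^2 \] and \[ \tilde R_{n,m}(t)=\frac{n!\,(t-n)_{2n-m}}{(t)_{n+1}\,(t)_{2n-m+1}} \sum_{j=0}^n{\binom nj}^2\binom{2n-m+j}{n}\frac{(t-j)_n}{n!}. \] Then \[ -\frac13\sum_{\nu=n-m+1}^\infty\frac{\mathrm{d} R_{n,m}(t)}{\mathrm{d} t}\bigg|_{t=\nu} =\frac16\sum_{\nu=1}^\infty\frac{\mathrm{d}^2\tilde R_{n,m}(t)}{\mathrm{d} t^2}\bigg|_{t=\nu}. \]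
   Context: For a quantity $x$ and an integer $k\ge0$, $(x)_k=x(x+1)\cdots(x+k-1)$ denotes the Pochhammer symbol (rising factorial), with $(x)_0=1$. Both rational functions have poles only at non-positive integers $t$, so all derivatives are evaluated at points of regularity, and both series converge. *)

(* Defs.v *)
From Stdlib Require Import Reals Arith Factorial Binomial.
From Coquelicot Require Import Coquelicot.
Open Scope R_scope.

Fixpoint poch (x : R) (k : nat) : R :=
  match k with
  | O => 1
  | S k' => poch x k' * (x + INR k')
  end.

Definition Rnm (n m : nat) (t : R) : R :=
  (-1) ^ m * (t + INR n / 2)
  * (poch (t - INR n) m / INR (fact m))
  * (poch (t - 2 * INR n + INR m) (2 * n - m) / INR (fact (2 * n - m)))
  * (poch (t + INR n + 1) n / poch t (n + 1))
  * (poch (t + INR n + 1) (2 * n - m) / poch t (2 * n - m + 1))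
  * (INR (fact n) / poch t (n + 1)) ^ 2.

Definition Rtnm (n m : nat) (t : R) : R :=
  INR (fact n) * poch (t - INR n) (2 * n - m)
  / (poch t (n + 1) * poch t (2 * n - m + 1))
  * sum_f_R0 (fun j => (Binomial.C n j) ^ 2 * Binomial.C (2 * n - m + j) n
                        * (poch (t - INR j) n / INR (fact n))) n.

(* Main.v *)
Require Import Defs.
From Stdlib Require Import Reals Arith Factorial Binomial.
From Coquelicot Require Import Coquelicot.
From Stdlib Require Import Lia Lra ZArith.
Open Scope R_scope.

(* Both sides, as functions of (n,m), satisfy the same recurrences.  For fixed n there is a
   three-term recurrence in m: on the well-poised side it has a hypergeometric (Gosper)
   certificate, on the other side it is obtained by creative telescoping in t and in the inner
   summation index j.  Because the recurrences come from identities between rational functions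
   of t, they may be differentiated in t before summing over t = 1, 2, ...; only the boundary
   terms have to be examined.  At m = 0 the recurrence involves the double sum at m = -1, whose
   series is an explicit product rho(n), while on the well-poised side rho(n) appears as a
   boundary term.  The initial values at m = 0 are handled in the same way by a first-order
   inhomogeneous recurrence in n, with inhomogeneity a multiple of rho(n), starting from
   n = m = 0, where both sides are the sum of the 1/t^4. *)

(** The delicate point is the two ends of the telescoping sums. For the double sum the part X
    telescoping in t is bounded only by O(t); its second derivative tends to 0 at infinity because
    every differentiation gains a power of t, and this is why decay is tracked together with all
    derivatives. At t = 1, X has only a simple zero in sight, and its second derivative vanishes
    there through an identity between harmonic numbers, which becomes one rational condition on the
    coefficients of each certificate. On the well-poised side all sums are started at n + 1,
    independently of m, because the terms from n - m + 1 to n come from double zeros. At n + 1 the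
    certificate of the recurrence in m again has a double zero, except at m = 0, where one of the
    two zeros is lost and the derivative is an explicit product of factorials. Everything is written
    with l = n - m. After cancellation l enters the double sum only as a shift, so it may be any
    real number and may exceed n. In this normalisation the double sum is -2 n! times the
    well-poised one, which accounts for the constants 1/3 and 1/6. *)

(** * Pochhammer symbols and their derivatives *)

Lemma poch_S_l (x : R) (k : nat) : poch x (S k) = x * poch (x + 1) k.
Proof.
induction k as [|k IH]; [simpl; ring|].
change (poch x (S k) * (x + INR (S k)) = x * (poch (x + 1) k * (x + 1 + INR k))).
rewrite IH, S_INR; ring.
Qed.

Lemma poch_add (x : R) (a b : nat) : poch x (a + b) = poch x a * poch (x + INR a) b.
Proof.
induction b as [|b IH]; [rewrite Nat.add_0_r; simpl; ring|].
rewrite Nat.add_succ_r; simpl; rewrite IH, plus_INR; ring.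
Qed.

Lemma poch_pos (x : R) (k : nat) : 0 < x -> 0 < poch x k.
Proof.
intros hx; induction k as [|k IH]; simpl; [lra|].
apply Rmult_lt_0_compat; [exact IH|]. generalize (pos_INR k); lra.
Qed.

Lemma poch_1 (k : nat) : poch 1 k = INR (fact k).
Proof.
induction k as [|k IH]; [simpl; ring|].
change (fact (S k)) with (S k * fact k)%nat.
rewrite mult_INR, S_INR; simpl; rewrite IH; ring.
Qed.

Lemma poch_fact (a b : nat) : poch (INR a + 1) b = INR (fact (a + b)) / INR (fact a).
Proof.
rewrite <- !poch_1, poch_add, (Rplus_comm 1). field.
apply Rgt_not_eq, poch_pos; lra.
Qed.

Lemma poch_neg (j : nat) : poch (- INR j) j = (-1) ^ j * INR (fact j).
Proof.
induction j as [|j IH]; [simpl; ring|].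
rewrite poch_S_l, S_INR. replace (- (INR j + 1) + 1) with (- INR j) by ring.
rewrite IH. change (fact (S j)) with (S j * fact j)%nat.
rewrite mult_INR, S_INR; simpl; ring.
Qed.

Lemma poch_neg_0 (j k : nat) : (j < k)%nat -> poch (- INR j) k = 0.
Proof.
intros h. replace k with (j + S (k - j - 1))%nat by lia.
rewrite poch_add, poch_S_l. ring.
Qed.

Fixpoint dpoch (x : R) (k : nat) : R :=
  match k with
  | O => 0
  | S k' => dpoch x k' * (x + INR k') + poch x k'
  end.

Lemma is_derive_poch (a : R) (k : nat) (t : R) :
  is_derive (fun t => poch (t + a) k) t (dpoch (t + a) k).
Proof.
induction k as [|k IH]; simpl; [apply (is_derive_const 1)|].
evar_last.
- apply (is_derive_mult (fun t => poch (t + a) k) (fun t => t + a + INR k));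
    [exact IH| |intros; apply Rmult_comm].
  auto_derive; [exact I|reflexivity].
- unfold plus, mult; simpl; ring.
Qed.

Lemma dpoch_add (x : R) (a b : nat) :
  dpoch x (a + b) = dpoch x a * poch (x + INR a) b + poch x a * dpoch (x + INR a) b.
Proof.
induction b as [|b IH]; [rewrite Nat.add_0_r; simpl; ring|].
rewrite Nat.add_succ_r; simpl; rewrite IH, poch_add, plus_INR; ring.
Qed.

(** At -j only the factor of index j vanishes, so the derivative is the product of the other
    factors, -j, ..., -1 and 1, ..., r. *)
Lemma dpoch_neg (j r : nat) :
  dpoch (- INR j) (j + S r) = (-1) ^ j * INR (fact j) * INR (fact r).
Proof.
rewrite dpoch_add, poch_neg.
replace (- INR j + INR j) with 0 by ring.
replace (S r) with (1 + r)%nat by lia. rewrite dpoch_add, poch_add.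
simpl. rewrite !Rplus_0_l, poch_1. ring.
Qed.

Fixpoint dlog (x : R) (k : nat) : R :=
  match k with
  | O => 0
  | S k' => dlog x k' + / (x + INR k')
  end.

Lemma dpoch_dlog (x : R) (k : nat) :
  (forall i, (i < k)%nat -> x + INR i <> 0) -> dpoch x k = poch x k * dlog x k.
Proof.
induction k as [|k IH]; intros h; simpl; [ring|].
rewrite IH by (intros i hi; apply h; lia). field. apply h; lia.
Qed.

(** * Functions with symbol-like decay *)

(* [symbol k d f]: on t > 0 the function f is k times differentiable, and its j-th derivative
   is O(t^(-d-j)) for j <= k.  Unlike a bound on f alone, this is stable under products, so it
   yields the convergence of all the series of derivatives at once. *)
Definition symbol_bound (d : Z) (f : R -> R) : Prop :=
  exists M, forall t, 1 <= t -> Rabs (f t) * powerRZ t d <= M.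

Fixpoint symbol (k : nat) (d : Z) (f : R -> R) : Prop :=
  symbol_bound d f /\
  match k with
  | O => True
  | S k' => (forall t, 0 < t -> ex_derive f t) /\ symbol k' (d + 1) (Derive f)
  end.

Lemma powerRZ_ge_1_pos (t : R) (d : Z) : 1 <= t -> 0 < powerRZ t d.
Proof. intros; apply powerRZ_lt; lra. Qed.

Lemma powerRZ_mono (t : R) (d d' : Z) : 1 <= t -> (d' <= d)%Z -> powerRZ t d' <= powerRZ t d.
Proof.
intros ht hd. replace d with (d' + Z.of_nat (Z.to_nat (d - d')))%Z by lia.
rewrite powerRZ_add, <- pow_powerRZ by lra.
rewrite <- (Rmult_1_r (powerRZ t d')) at 1.
apply Rmult_le_compat_l; [left; apply powerRZ_ge_1_pos, ht|].
apply pow_R1_Rle, ht.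
Qed.

Lemma locally_pos (t : R) : 0 < t -> locally t (fun y => 0 < y).
Proof.
intros ht. exists (mkposreal t ht). intros y hy.
unfold ball in hy; simpl in hy; unfold AbsRing_ball, abs, minus, plus, opp in hy; simpl in hy.
apply Rabs_lt_between in hy. lra.
Qed.

Lemma eq_pos_locally (f g : R -> R) (t : R) :
  (forall t, 0 < t -> f t = g t) -> 0 < t -> locally t (fun y => f y = g y).
Proof.
intros h ht. generalize (locally_pos t ht). apply filter_imp. exact h.
Qed.

Lemma Derive_ext_pos (f g : R -> R) :
  (forall t, 0 < t -> f t = g t) -> forall t, 0 < t -> Derive f t = Derive g t.
Proof. intros h t ht; apply Derive_ext_loc, eq_pos_locally; auto. Qed.

Lemma symbol_bound_ext (d : Z) (f g : R -> R) :
  (forall t, 0 < t -> f t = g t) -> symbol_bound d f -> symbol_bound d g.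
Proof.
intros h [M hM]; exists M; intros t ht. rewrite <- h by lra. apply hM, ht.
Qed.

Lemma symbol_ext (k : nat) : forall (d : Z) (f g : R -> R),
  (forall t, 0 < t -> f t = g t) -> symbol k d f -> symbol k d g.
Proof.
induction k as [|k IH]; intros d f g h [hb hk]; split;
  try (apply (symbol_bound_ext d f g h hb)); [exact I|].
destruct hk as [hd hs]. split.
- intros t ht. apply (ex_derive_ext_loc f); [|apply hd, ht]. apply eq_pos_locally; auto.
- apply (IH _ (Derive f)); [|exact hs]. apply Derive_ext_pos, h.
Qed.

Lemma symbol_bound_le (d d' : Z) (f : R -> R) : (d' <= d)%Z -> symbol_bound d f -> symbol_bound d' f.
Proof.
intros h [M hM]; exists M; intros t ht. eapply Rle_trans; [|apply (hM t ht)].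
apply Rmult_le_compat_l; [apply Rabs_pos|]. apply powerRZ_mono; auto.
Qed.

Lemma symbol_le (k : nat) : forall (k' : nat) (d d' : Z) (f : R -> R),
  (k' <= k)%nat -> (d' <= d)%Z -> symbol k d f -> symbol k' d' f.
Proof.
induction k as [|k IH]; intros k' d d' f hk hd [hb hs].
- replace k' with 0%nat by lia. split; [apply (symbol_bound_le d); auto|exact I].
- destruct k' as [|k']; (split; [apply (symbol_bound_le d); auto|]); [exact I|].
  destruct hs as [h1 h2]; split; [exact h1|]. apply (IH k' (d + 1)%Z); [lia|lia|exact h2].
Qed.

Lemma symbol_cast (k : nat) (d d' : Z) (f : R -> R) : symbol k d f -> (d' <= d)%Z -> symbol k d' f.
Proof. intros h hd; apply (symbol_le k k d); auto. Qed.

Lemma symbol_bound_plus (d : Z) (f g : R -> R) : symbol_bound d f -> symbol_bound d g -> symbol_bound d (fun t => f t + g t).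
Proof.
intros [M hM] [N hN]; exists (M + N); intros t ht.
generalize (hM t ht) (hN t ht) (Rabs_triang (f t) (g t)) (powerRZ_ge_1_pos t d ht); intros.
nra.
Qed.

Lemma symbol_bound_mult (d e : Z) (f g : R -> R) :
  symbol_bound d f -> symbol_bound e g -> symbol_bound (d + e) (fun t => f t * g t).
Proof.
intros [M hM] [N hN]; exists (M * N); intros t ht.
rewrite Rabs_mult, powerRZ_add by lra.
replace (Rabs (f t) * Rabs (g t) * (powerRZ t d * powerRZ t e))
  with ((Rabs (f t) * powerRZ t d) * (Rabs (g t) * powerRZ t e)) by ring.
apply Rmult_le_compat; auto;
  apply Rmult_le_pos; try apply Rabs_pos; left; apply powerRZ_ge_1_pos, ht.
Qed.

Lemma symbol_plus (k : nat) : forall (d : Z) (f g : R -> R),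
  symbol k d f -> symbol k d g -> symbol k d (fun t => f t + g t).
Proof.
induction k as [|k IH]; intros d f g [hf hf'] [hg hg']; split;
  try (apply symbol_bound_plus; assumption); [exact I|].
destruct hf' as [hf1 hf2], hg' as [hg1 hg2]. split.
- intros t ht. apply @ex_derive_plus; auto.
- apply (symbol_ext _ _ (fun t => Derive f t + Derive g t)); [|apply IH; assumption].
  intros t ht. symmetry; apply Derive_plus; auto.
Qed.

Lemma symbol_mult (k : nat) : forall (d e : Z) (f g : R -> R),
  symbol k d f -> symbol k e g -> symbol k (d + e) (fun t => f t * g t).
Proof.
induction k as [|k IH]; intros d e f g hf hg.
- split; [apply symbol_bound_mult; [apply hf|apply hg]|exact I].
(* The Leibniz rule pairs a derivative with an undifferentiated factor, so the induction hypothesis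
   is also needed for f and g themselves at level k. *)
- assert (hf0 : symbol k d f) by (apply (symbol_le (S k) k d); auto; lia).
  assert (hg0 : symbol k e g) by (apply (symbol_le (S k) k e); auto; lia).
  destruct hf as [hf [hf1 hf2]], hg as [hg [hg1 hg2]].
  split; [apply symbol_bound_mult; assumption|split].
  + intros t ht. apply ex_derive_mult; auto.
  + apply (symbol_ext _ _ (fun t => Derive f t * g t + f t * Derive g t)).
    * intros t ht. symmetry; apply Derive_mult; auto.
    * apply symbol_plus.
      -- apply (symbol_cast _ (d + 1 + e)); [apply IH; assumption|lia].
      -- apply (symbol_cast _ (d + (e + 1))); [apply IH; assumption|lia].
Qed.

Lemma symbol_const (k : nat) (c : R) : symbol k 0 (fun _ => c).
Proof.
(* The derivative of a constant must gain an order at every level; being zero, it has every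
   order. *)
assert (h0 : forall k d, symbol k d (fun _ => 0)).
{ intros k'; induction k' as [|k' IH]; intros d; split;
    try (exists 0; intros; rewrite Rabs_R0; lra); [exact I|].
  split; [intros; apply ex_derive_const|].
  apply (symbol_ext _ _ (fun _ => 0)); [|apply IH]. intros; symmetry; apply Derive_const. }
destruct k as [|k]; split; try (exists (Rabs c); intros; simpl; lra); [exact I|].
split; [intros; apply ex_derive_const|].
apply (symbol_ext _ _ (fun _ => 0)); [|apply h0]. intros; symmetry; apply Derive_const.
Qed.

Lemma symbol_id (k : nat) : symbol k (-1) (fun t => t).
Proof.
destruct k as [|k]; split;
  try (exists 1; intros t ht; simpl; rewrite Rabs_pos_eq by lra; rewrite Rmult_1_r, Rinv_r; lra);
  [exact I|].
split; [intros; apply ex_derive_id|].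
apply (symbol_ext _ _ (fun _ => 1)); [|apply (symbol_const k 1)].
intros; symmetry; apply Derive_id.
Qed.

(** The derivative is minus the square of the function, so the induction closes through
    [symbol_mult]. *)
Lemma symbol_inv (k : nat) (a : R) : 0 <= a -> symbol k 1 (fun t => / (t + a)).
Proof.
intros ha.
assert (hb : symbol_bound 1 (fun t => / (t + a))).
{ exists 1; intros t ht. rewrite powerRZ_1, Rabs_pos_eq.
  - apply (Rmult_le_reg_l (t + a)); [lra|]. field_simplify; lra.
  - left; apply Rinv_0_lt_compat; lra. }
induction k as [|k IH]; split; try exact hb; [exact I|]. split.
- intros t ht. auto_derive; lra.
- apply (symbol_ext _ _ (fun t => -1 * (/ (t + a) * / (t + a)))).
  + intros t ht. symmetry. apply is_derive_unique. auto_derive; [lra|]. field; lra.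
  + change (1 + 1)%Z with (0 + (1 + 1))%Z.
    apply (symbol_mult k 0 2 (fun _ => -1)); [apply symbol_const|]. apply (symbol_mult k 1 1); exact IH.
Qed.

Lemma symbol_shift (k : nat) (a : R) : symbol k (-1) (fun t => t + a).
Proof.
apply symbol_plus; [apply symbol_id|]. apply (symbol_cast _ 0); [apply symbol_const|lia].
Qed.

Lemma symbol_poch (k n : nat) (a : R) : symbol k (- Z.of_nat n) (fun t => poch (t + a) n).
Proof.
induction n as [|n IH]; [apply (symbol_const k 1)|].
apply (symbol_cast _ (- Z.of_nat n + -1)); [|lia]. apply symbol_mult; [exact IH|].
apply (symbol_ext _ _ (fun t => t + (a + INR n))); [intros; ring|apply symbol_shift].
Qed.

Lemma symbol_inv_poch (k n : nat) (a : R) :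
  0 <= a -> symbol k (Z.of_nat n) (fun t => / poch (t + a) n).
Proof.
intros ha. induction n as [|n IH].
- apply (symbol_ext _ _ (fun _ => 1)); [intros; simpl; field|apply symbol_const].
- apply (symbol_cast _ (Z.of_nat n + 1)); [|lia].
  apply (symbol_ext _ _ (fun t => / poch (t + a) n * / (t + (a + INR n)))).
  + intros t ht. simpl. rewrite <- Rinv_mult. f_equal. ring.
  + apply symbol_mult; [exact IH|]. apply symbol_inv. generalize (pos_INR n); lra.
Qed.

Lemma symbol_sum (k N : nat) (d : Z) (f : nat -> R -> R) :
  (forall i, symbol k d (f i)) -> symbol k d (fun t => sum_f_R0 (fun i => f i t) N).
Proof.
intros h; induction N as [|N IH]; simpl; [apply h|]. apply symbol_plus; auto.
Qed.

Lemma Derive_n_Derive (f : R -> R) (j : nat) (t : R) :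
  Derive_n (Derive f) j t = Derive_n f (S j) t.
Proof.
revert t; induction j as [|j IH]; intros t; [reflexivity|].
simpl. apply Derive_ext. exact IH.
Qed.

Lemma symbol_ex_derive_n (k : nat) : forall (d : Z) (f : R -> R) (j : nat) (t : R),
  symbol k d f -> (j <= k)%nat -> 0 < t -> ex_derive_n f j t.
Proof.
induction k as [|k IH]; intros d f j t [hb hs] hj ht.
- replace j with 0%nat by lia. exact I.
- destruct hs as [h1 h2]. destruct j as [|j]; [exact I|].
  destruct j as [|j]; [apply h1, ht|].
  assert (h := IH _ _ (S j) t h2 ltac:(lia) ht). simpl in h |- *.
  revert h; apply ex_derive_ext. intros y. apply Derive_n_Derive.
Qed.

Lemma symbol_bnd (k : nat) : forall (d : Z) (f : R -> R),
  symbol k d f -> symbol_bound (d + Z.of_nat k) (Derive_n f k).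
Proof.
induction k as [|k IH]; intros d f [hb hs].
- apply (symbol_bound_le d); [lia|exact hb].
- destruct hs as [h1 h2]. apply (symbol_bound_ext _ (Derive_n (Derive f) k)).
  + intros t _. apply Derive_n_Derive.
  + apply (symbol_bound_le (d + 1 + Z.of_nat k)); [lia|]. apply IH, h2.
Qed.

(** * Series of derivatives *)

Lemma is_series_tele (g : nat -> R) :
  is_lim_seq g 0 -> is_series (fun k => g (S k) - g k) (- g 0%nat).
Proof.
intros h. change (is_lim_seq (sum_n (fun k => g (S k) - g k)) (- g 0%nat)).
apply (is_lim_seq_ext (fun n => g (S n) - g 0%nat)).
- intros n; induction n as [|n IH]; [rewrite sum_O; reflexivity|].
  rewrite sum_Sn, <- IH. unfold plus; simpl; ring.
- replace (Finite (- g 0%nat)) with (Finite (0 - g 0%nat)) by (f_equal; ring).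
  apply is_lim_seq_minus'; [apply (is_lim_seq_incr_1 g 0), h|apply is_lim_seq_const].
Qed.

Lemma is_lim_seq_inv_INR (s : nat) (M : R) : is_lim_seq (fun i => M * / INR (i + s)) 0.
Proof.
apply (is_lim_seq_incr_n (fun i => M * / INR i) s 0).
replace (Finite 0) with (Rbar_mult M 0) by (simpl; f_equal; ring).
apply is_lim_seq_scal_l.
replace (Finite 0) with (Rbar_inv p_infty) by reflexivity.
apply is_lim_seq_inv; [apply is_lim_seq_INR|discriminate].
Qed.

Lemma INR_ge_1 (i s : nat) : (1 <= s)%nat -> 1 <= INR (i + s).
Proof. intros hs. apply (le_INR 1); lia. Qed.

Lemma symbol_lim (k : nat) (d : Z) (f : R -> R) (s : nat) :
  symbol k d f -> (1 <= d + Z.of_nat k)%Z -> (1 <= s)%nat ->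
  is_lim_seq (fun i => Derive_n f k (INR (i + s))) 0.
Proof.
intros hf hd hs. destruct (symbol_bound_le _ 1 _ hd (symbol_bnd k d f hf)) as [M hM].
assert (hb : forall i, - (M * / INR (i + s)) <= Derive_n f k (INR (i + s)) <= M * / INR (i + s)).
{ intros i. apply Rabs_le_between. assert (h1 := INR_ge_1 i s hs).
  specialize (hM _ h1). rewrite powerRZ_1 in hM.
  apply (Rmult_le_reg_r (INR (i + s))); [lra|].
  rewrite Rmult_assoc, Rinv_l, Rmult_1_r by lra. exact hM. }
apply (is_lim_seq_le_le (fun i => - (M * / INR (i + s))) _ (fun i => M * / INR (i + s))).
- exact hb.
- replace (Finite 0) with (Rbar_opp 0) by (simpl; f_equal; ring).
  apply -> is_lim_seq_opp. apply is_lim_seq_inv_INR.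
- apply is_lim_seq_inv_INR.
Qed.

Lemma ex_series_inv_sq : ex_series (fun i => / (INR (i + 1) * INR (i + 2))).
Proof.
exists (- - / INR (0 + 1)).
apply (is_series_ext (fun i => (- / INR (S i + 1)) - (- / INR (i + 1)))).
- intros i. replace (S i + 1)%nat with (i + 2)%nat by lia.
  assert (h1 := INR_ge_1 i 1 (le_n _)). assert (h2 := INR_ge_1 i 2 ltac:(lia)).
  rewrite (plus_INR i 2), (plus_INR i 1) in *. simpl in *. field; lra.
- apply (is_series_tele (fun i => - / INR (i + 1))).
  replace (Finite 0) with (Rbar_opp 0) by (simpl; f_equal; ring).
  apply -> is_lim_seq_opp.
  apply (is_lim_seq_ext (fun i => 1 * / INR (i + 1))); [intros; ring|].
  apply is_lim_seq_inv_INR.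
Qed.

Lemma symbol_ex_series (k : nat) (d : Z) (f : R -> R) (s : nat) :
  symbol k d f -> (2 <= d + Z.of_nat k)%Z -> (1 <= s)%nat ->
  ex_series (fun i => Derive_n f k (INR (i + s))).
Proof.
intros hf hd hs. destruct (symbol_bound_le _ 2 _ hd (symbol_bnd k d f hf)) as [M hM].
(* The factor 2 comes from (i+1)(i+2) <= 2(i+1)^2; the comparison series is the telescoping one. *)
apply (@ex_series_le R_AbsRing R_CompleteNormedModule _
         (fun i => 2 * M * / (INR (i + 1) * INR (i + 2)))).
- intros i. change (Rabs (Derive_n f k (INR (i + s))) <= 2 * M * / (INR (i + 1) * INR (i + 2))).
  assert (h1 := INR_ge_1 i 1 (le_n _)).
  assert (h2 : INR (i + 2) = INR (i + 1) + 1) by (rewrite !plus_INR; simpl; ring).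
  assert (h3 : INR (i + 1) <= INR (i + s)) by (apply le_INR; lia).
  specialize (hM (INR (i + s)) ltac:(lra)).
  replace (powerRZ (INR (i + s)) 2) with (INR (i + s) * INR (i + s)) in hM by (simpl; ring).
  assert (h0 := Rabs_pos (Derive_n f k (INR (i + s)))).
  apply (Rmult_le_reg_r (INR (i + 1) * INR (i + 2))); [nra|].
  rewrite (Rmult_assoc (2 * M)), Rinv_l, Rmult_1_r by nra.
  set (D := Rabs _) in *.
  assert (INR (i + 1) * INR (i + 1) <= INR (i + s) * INR (i + s)) by nra.
  assert (D * (INR (i + 1) * INR (i + 1)) <= M) by nra.
  assert (0 <= D * (INR (i + 1) * (INR (i + 1) - 1))).
  { apply Rmult_le_pos; [exact h0|]. apply Rmult_le_pos; lra. }
  rewrite h2. lra.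
- apply (@ex_series_scal R_AbsRing R_NormedModule (2 * M)). apply ex_series_inv_sq.
Qed.

Definition dseries (k s : nat) (f : R -> R) : R := Series (fun i => Derive_n f k (INR (i + s))).

Lemma symbol_ex_derive_n_loc (k : nat) (d : Z) (f : R -> R) (t : R) :
  symbol k d f -> 0 < t -> locally t (fun y => forall j, (j <= k)%nat -> ex_derive_n f j y).
Proof.
intros hf ht. generalize (locally_pos t ht). apply filter_imp.
intros y hy j hj. apply (symbol_ex_derive_n k d); assumption.
Qed.

(** Differentiation commutes with the shift t -> t + 1, so the k-th derivatives telescope as well. G
    itself may grow; only its k-th derivative has to tend to 0. *)
Lemma dseries_tele (k s : nat) (d : Z) (f G : R -> R) :
  symbol k d G -> (1 <= d + Z.of_nat k)%Z -> (1 <= s)%nat ->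
  (forall t, 0 < t -> f t = G (t + 1) - G t) ->
  is_series (fun i => Derive_n f k (INR (i + s))) (- Derive_n G k (INR s)).
Proof.
intros hG hd hs h.
apply (is_series_ext (fun i => Derive_n G k (INR (S i + s)) - Derive_n G k (INR (i + s)))).
- intros i. assert (h1 := INR_ge_1 i s hs).
  rewrite (Derive_n_ext_loc f (fun t => G (t + 1) - G t))
    by (apply eq_pos_locally; [exact h|lra]).
  rewrite (Derive_n_minus (fun t => G (t + 1)) G).
  + rewrite Derive_n_comp_trans. f_equal. f_equal. rewrite <- S_INR. f_equal. 
  + generalize (locally_pos (INR (i + s)) ltac:(lra)). apply filter_imp.
    intros y hy j hj. apply ex_derive_n_comp_trans.
    apply (symbol_ex_derive_n k d); [assumption|assumption|lra].
  + apply (symbol_ex_derive_n_loc k d); [exact hG|lra].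
- apply (is_series_tele (fun i => Derive_n G k (INR (i + s)))).
  apply (symbol_lim k d); assumption.
Qed.

(** Turns a certificate into a relation between series. First-order recurrences use it with a third
    coefficient equal to 0. *)
Lemma dseries_lin (k s : nat) (d e : Z) (f g h G : R -> R) (a b c : R) :
  symbol k d f -> symbol k d g -> symbol k d h -> (2 <= d + Z.of_nat k)%Z ->
  symbol k e G -> (1 <= e + Z.of_nat k)%Z -> (1 <= s)%nat ->
  (forall t, 0 < t -> a * f t + b * g t + c * h t = G (t + 1) - G t) ->
  a * dseries k s f + b * dseries k s g + c * dseries k s h = - Derive_n G k (INR s).
Proof.
intros hf hg hh hd hG he hs H. unfold dseries.
rewrite <- (is_series_unique _ _ (dseries_tele k s e _ G hG he hs H)).
rewrite <- !Series_scal_l.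
assert (X := fun u hu => symbol_ex_series k d u s hu hd hs).
rewrite <- Series_plus, <- Series_plus.
- apply Series_ext. intros i. assert (h1 := INR_ge_1 i s hs).
  assert (L : forall (x : R) u, symbol k d u -> locally (INR (i + s)) (fun y =>
     forall j, (j <= k)%nat -> ex_derive_n (fun t => x * u t) j y)).
  { intros x u hu. apply (symbol_ex_derive_n_loc k (0 + d)); [|lra].
    apply (symbol_mult k 0 d (fun _ => x)); [apply symbol_const|exact hu]. }
  rewrite (Derive_n_plus (fun t => a * f t + b * g t) (fun t => c * h t)).
  + rewrite (Derive_n_plus (fun t => a * f t) (fun t => b * g t)); [|apply L, hf|apply L, hg].
    rewrite !Derive_n_scal_l. reflexivity.
  + apply (symbol_ex_derive_n_loc k d); [|lra].
    apply symbol_plus; apply (symbol_cast k (0 + d)); try lia;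
      apply (symbol_mult k 0 d (fun _ => _)); auto using symbol_const.
  + apply L, hh.
- apply (@ex_series_plus R_AbsRing R_NormedModule); 
    apply (@ex_series_scal R_AbsRing R_NormedModule); auto.
- apply (@ex_series_scal R_AbsRing R_NormedModule); auto.
- apply (@ex_series_scal R_AbsRing R_NormedModule); auto.
- apply (@ex_series_scal R_AbsRing R_NormedModule); auto.
Qed.

(** * Finite differences and harmonic numbers *)

(* [Binomial.C n j] is not 0 for j > n (truncated subtraction); [bc] is. *)
Definition bc (n j : nat) : R := if (j <=? n)%nat then Binomial.C n j else 0.

Lemma bc_C (n j : nat) : (j <= n)%nat -> bc n j = Binomial.C n j.
Proof. intros h; unfold bc. apply Nat.leb_le in h; rewrite h; reflexivity. Qed.

Lemma bc_0 (n j : nat) : (n < j)%nat -> bc n j = 0.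
Proof. intros h; unfold bc. apply Nat.leb_gt in h; rewrite h; reflexivity. Qed.

Lemma bc_n_0 (n : nat) : bc n 0 = 1.
Proof. rewrite bc_C by lia. unfold Binomial.C. rewrite Nat.sub_0_r. simpl (fact 0). simpl (INR 1). field. apply INR_fact_neq_0. Qed.

Lemma fact_S (n : nat) : INR (fact (S n)) = (INR n + 1) * INR (fact n).
Proof. change (fact (S n)) with (S n * fact n)%nat. rewrite mult_INR, S_INR. reflexivity. Qed.

(** Like the next identities, stated without division and for all j, which the value 0 beyond n
    permits; sums can then be shifted without range conditions. *)
Lemma bc_S_r (n j : nat) : (INR j + 1) * bc n (S j) = (INR n - INR j) * bc n j.
Proof.
destruct (lt_eq_lt_dec j n) as [[h|h]|h].
- rewrite !bc_C by lia. unfold Binomial.C. replace (n - j)%nat with (S (n - S j)) by lia.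
  rewrite !fact_S. replace (INR n) with (INR (n - S j) + 1 + INR j).
  + field. repeat split; try apply INR_fact_neq_0; rewrite <- S_INR; apply not_0_INR; lia.
  + rewrite minus_INR, S_INR by lia. ring.
- subst. rewrite (bc_0 n (S n)) by lia. ring.
- rewrite !bc_0 by lia. ring.
Qed.

Lemma bc_S_S (n j : nat) : (INR j + 1) * bc (S n) (S j) = (INR n + 1) * bc n j.
Proof.
destruct (le_lt_dec j n) as [h|h].
- rewrite !bc_C by lia. unfold Binomial.C. simpl (S n - S j)%nat. rewrite !fact_S.
  field. repeat split; try apply INR_fact_neq_0; rewrite <- S_INR; apply not_0_INR; lia.
- rewrite !bc_0 by lia. ring.
Qed.

Lemma bc_pascal (n j : nat) : bc (S n) (S j) = bc n j + bc n (S j).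
Proof.
apply (Rmult_eq_reg_l (INR j + 1)); [|rewrite <- S_INR; apply not_0_INR; lia].
rewrite Rmult_plus_distr_l, bc_S_S, bc_S_r. ring.
Qed.

Lemma bc_S_l (n j : nat) : (INR n + 1 - INR j) * bc (S n) j = (INR n + 1) * bc n j.
Proof.
destruct j as [|j].
- rewrite !bc_n_0. simpl; ring.
- rewrite bc_pascal. assert (h := bc_S_r n j). rewrite S_INR. nra.
Qed.

(* [fd d q]: q behaves like a polynomial of degree at most d, i.e. its differences of order > d
   vanish. *)
Definition fd (d : nat) (q : nat -> R) : Prop :=
  forall M s, (d < M)%nat -> sum_f_R0 (fun i => (-1) ^ i * bc M i * q (i + s)%nat) M = 0.

Lemma fd_const (c : R) : fd 0 (fun _ => c).
Proof.
intros M s hM. rewrite (sum_eq _ (fun i => (Binomial.C M i * (-1) ^ i * 1 ^ (M - i)) * c)).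
- rewrite <- scal_sum, <- binomial. replace (-1 + 1) with 0 by ring.
  rewrite pow_i by lia. ring.
- intros i hi. rewrite bc_C by exact hi. rewrite pow1. ring.
Qed.

Lemma fd_le (d e : nat) (q : nat -> R) : (d <= e)%nat -> fd d q -> fd e q.
Proof. intros h hq M s hM; apply hq; lia. Qed.

Lemma fd_lin (d : nat) (a b : R) (p q : nat -> R) :
  fd d p -> fd d q -> fd d (fun i => a * p i + b * q i).
Proof.
intros hp hq M s hM.
rewrite (sum_eq _ (fun i => ((-1) ^ i * bc M i * p (i + s)%nat) * a + ((-1) ^ i * bc M i * q (i + s)%nat) * b))
  by (intros; ring).
rewrite sum_plus, <- !scal_sum, hp, hq by exact hM. ring.
Qed.

(** By absorption, i binom(M, i) = M binom(M-1, i-1): the order of the difference drops by one and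
    the argument of q moves by one, which is why [fd] quantifies over the shift s. *)
Lemma fd_mul_id (d : nat) (q : nat -> R) : fd d q -> fd (S d) (fun i => INR i * q i).
Proof.
intros hq M s hM. destruct M as [|M]; [lia|].
rewrite (sum_eq _ (fun i => ((-1) ^ i * bc (S M) i * q (i + s)%nat) * INR s
                     + (-1) ^ i * (INR i * bc (S M) i) * q (i + s)%nat))
  by (intros; rewrite plus_INR; ring).
rewrite sum_plus, <- scal_sum, hq, decomp_sum by lia. simpl pred.
rewrite (sum_eq _ (fun i => ((-1) ^ i * bc M i * q (i + S s)%nat) * (- (INR M + 1)))).
- rewrite <- scal_sum, hq by lia. simpl; ring.
- intros i _. rewrite S_INR, bc_S_S. replace (S i + s)%nat with (i + S s)%nat by lia.
  simpl; ring.
Qed.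

Lemma fd_mul (d : nat) (a : R) (q : nat -> R) :
  fd d q -> fd (S d) (fun i => (INR i + a) * q i).
Proof.
intros hq M s hM.
rewrite <- (fd_lin (S d) 1 a _ _ (fd_mul_id d q hq) (fd_le d (S d) q (Nat.le_succ_diag_r d) hq) M s hM).
apply sum_eq; intros; ring.
Qed.

Lemma fd_poch (c : R) (k : nat) : fd k (fun i => poch (c + INR i) k).
Proof.
induction k as [|k IH]; [apply (fd_const 1)|].
intros M s hM. rewrite <- (fd_mul k (c + INR k) _ IH M s hM).
apply sum_eq; intros; simpl; ring.
Qed.

Fixpoint harm (n : nat) : R := match n with O => 0 | S n' => harm n' + / (INR n' + 1) end.

(* For a polynomial q of degree at most n+1 it equals - q'(0) - q(0) H_(n+1). *)
Definition hsum (n : nat) (q : nat -> R) : R :=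
  sum_f_R0 (fun i => (-1) ^ S i * bc (S n) (S i) * q (S i) * / (INR i + 1)) n.

Lemma INR_S_neq_0 (i : nat) : INR i + 1 <> 0.
Proof. rewrite <- S_INR; apply not_0_INR; lia. Qed.

(** The full alternating sum vanishes, so omitting the index 0 leaves minus that term. *)
Lemma sum_bc_S (n : nat) (q : nat -> R) (d : nat) :
  fd d q -> (d <= n)%nat ->
  sum_f_R0 (fun i => (-1) ^ S i * bc (S n) (S i) * q (S i)) n = - q 0%nat.
Proof.
intros hq hd. assert (h := hq (S n) 0%nat ltac:(lia)).
rewrite decomp_sum in h by lia. simpl pred in h.
rewrite bc_n_0 in h.
rewrite (sum_eq _ (fun i => (-1) ^ S i * bc (S n) (S i) * q (S i + 0)%nat))
  by (intros; rewrite Nat.add_0_r; reflexivity).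
simpl in h |- *. lra.
Qed.

(** Pascal and absorption give binom(n+2, i+1)/(i+1) = binom(n+1, i+1)/(i+1) + binom(n+2,
    i+1)/(n+2); the alternating sum of the last term contributes -1/(n+2). *)
Lemma hsum_1 (n : nat) : hsum n (fun _ => 1) = - harm (S n).
Proof.
unfold hsum. induction n as [|n IH].
- simpl. unfold bc; simpl. unfold Binomial.C; simpl. field.
- rewrite (sum_eq _ (fun i => (-1) ^ S i * bc (S n) (S i) * 1 * / (INR i + 1)
     + ((-1) ^ S i * bc (S (S n)) (S i) * 1) * / (INR (S n) + 1))).
  + rewrite sum_plus, <- scal_sum, (sum_bc_S (S n) (fun _ => 1) 0) by (try apply (fd_const 1); lia).
    rewrite tech5, IH, (bc_0 (S n) (S (S n))) by lia. simpl harm. ring_simplify. reflexivity.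
  + intros i _. assert (h := bc_S_S (S n) i). rewrite (bc_pascal (S n) i).
    rewrite (bc_pascal (S n) i) in h.
    assert (h1 := INR_S_neq_0 i). assert (h2 := INR_S_neq_0 (S n)).
    assert (bc (S n) i = (INR i + 1) * (bc (S n) i + bc (S n) (S i)) * / (INR (S n) + 1))
      by (rewrite h; field; exact h2).
    set (u := bc (S n) i) in *. set (v := bc (S n) (S i)) in *.
    replace ((-1) ^ S i * (u + v) * 1 * / (INR i + 1))
      with ((-1) ^ S i * v * 1 * / (INR i + 1) + (-1) ^ S i * / (INR i + 1) * u) by ring.
    rewrite H at 1. field. split; assumption.
Qed.

Lemma hsum_lin (n : nat) (a b : R) (p q : nat -> R) :
  hsum n (fun i => a * p i + b * q i) = a * hsum n p + b * hsum n q.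
Proof.
unfold hsum. rewrite !(scal_sum _ _ a), !(scal_sum _ _ b), <- sum_plus.
apply sum_eq; intros; ring.
Qed.

Lemma hsum_mul_id (n d : nat) (q : nat -> R) :
  fd d q -> (d <= n)%nat -> hsum n (fun i => INR i * q i) = - q 0%nat.
Proof.
intros hq hd. rewrite <- (sum_bc_S n q d hq hd). unfold hsum. apply sum_eq.
intros i _. rewrite S_INR. field. apply INR_S_neq_0.
Qed.

Lemma hsum_poch (n : nat) (c : R) (k : nat) : (k <= S n)%nat ->
  hsum n (fun i => poch (c + INR i) k) = - (dpoch c k + poch c k * harm (S n)).
Proof.
induction k as [|k IH]; intros hk.
- simpl (poch _ 0). rewrite hsum_1. simpl. ring.
(* The last factor c + i + k is split as i + (c + k): the first part cancels the denominator, the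
   second is the induction hypothesis. *)
- transitivity (hsum n (fun i => 1 * (INR i * poch (c + INR i) k) + (c + INR k) * poch (c + INR i) k)).
  + unfold hsum; apply sum_eq; intros; simpl; ring.
  + rewrite hsum_lin, IH, (hsum_mul_id n k) by (try apply fd_poch; lia).
    simpl poch; simpl dpoch. rewrite Rplus_0_r. ring.
Qed.

(** The coefficient e2 disappears because i times the Pochhammer symbol vanishes at i = 0; k < n
    leaves room for the two extra degrees. *)
Lemma hsum_quad (n : nat) (c e0 e1 e2 : R) (k : nat) : (k < n)%nat ->
  hsum n (fun i => (e0 + e1 * INR i + e2 * INR i ^ 2) * poch (c + INR i) k)
  = - (e0 * (dpoch c k + poch c k * harm (S n)) + e1 * poch c k).
Proof.
intros hk.
transitivity (hsum n (fun i => e0 * poch (c + INR i) k + 1 * (e1 * (INR i * poch (c + INR i) k)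
    + e2 * (INR i * (INR i * poch (c + INR i) k))))).
- unfold hsum; apply sum_eq; intros; ring.
- rewrite !hsum_lin, hsum_poch, (hsum_mul_id n k), (hsum_mul_id n (S k)) by
    (try apply fd_mul_id; try apply fd_poch; lia).
  rewrite Rplus_0_r. simpl. ring.
Qed.

Lemma is_derive_sum_f_R0 (f : nat -> R -> R) (df : nat -> R) (t : R) (N : nat) :
  (forall i, (i <= N)%nat -> is_derive (f i) t (df i)) ->
  is_derive (fun t => sum_f_R0 (fun i => f i t) N) t (sum_f_R0 df N).
Proof.
induction N as [|N IH]; intros h; simpl; [apply h; lia|].
apply @is_derive_plus; [apply IH; intros; apply h; lia|apply h; lia].
Qed.

(** * Certificates for the double sum *)

(* In each creative-telescoping identity below, the part telescoping in t is (after summation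
   over i = j + 1) of the shape [Xf], with coefficients e0, ..., g2 depending on n and m only. *)
Definition Xs (n k : nat) (c t : R) : R :=
  poch (t - INR n - 1) (S n) / (poch t k * poch (t + c - 1) (n + 2)).

Definition Xt (n : nat) (c e0 e1 e2 g0 g1 g2 : R) (i : nat) (t : R) : R :=
  bc (S n) i ^ 2
  * (e0 + e1 * INR i + e2 * INR i ^ 2 + (t - 1) * (g0 + g1 * INR i + g2 * INR i ^ 2))
  * poch (c + INR i) (n - 1) * poch (t - INR i) (S n).

Definition Xf (n k : nat) (c e0 e1 e2 g0 g1 g2 t : R) : R :=
  Xs n k c t * sum_f_R0 (fun i => Xt n c e0 e1 e2 g0 g1 g2 i t) (S n).

Lemma symbol_Xt (k n : nat) (c e0 e1 e2 g0 g1 g2 : R) (i : nat) :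
  symbol k (- 1 - Z.of_nat (S n)) (Xt n c e0 e1 e2 g0 g1 g2 i).
Proof.
unfold Xt.
apply (symbol_ext k _ (fun t => ((bc (S n) i ^ 2 * poch (c + INR i) (n - 1)) *
  ((e0 + e1 * INR i + e2 * INR i ^ 2) + (t + -1) * (g0 + g1 * INR i + g2 * INR i ^ 2)))
  * poch (t + - INR i) (S n))); [intros t _; unfold Rminus; ring|].
eapply symbol_cast; [apply symbol_mult; [|apply symbol_poch]|].
- apply (symbol_mult k 0 (-1) (fun _ => _)); [apply symbol_const|].
  apply symbol_plus; [apply (symbol_cast k 0); [apply symbol_const|lia]|].
  apply (symbol_cast k (-1 + 0)); [|lia].
  apply symbol_mult; [apply symbol_shift|apply symbol_const].
- lia.
Qed.

Lemma symbol_Xf (p n k : nat) (c e0 e1 e2 g0 g1 g2 : R) : 1 <= c ->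
  symbol p (Z.of_nat k - Z.of_nat n - 1) (Xf n k c e0 e1 e2 g0 g1 g2).
Proof.
intros hc. unfold Xf.
apply (symbol_ext p _ (fun t => (poch (t + (- INR n - 1)) (S n) * (/ poch (t + 0) k * / poch (t + (c - 1)) (n + 2)))
   * sum_f_R0 (fun i => Xt n c e0 e1 e2 g0 g1 g2 i t) (S n))).
- intros t ht. unfold Xs, Rdiv. rewrite Rinv_mult, Rplus_0_r.
  replace (t + (- INR n - 1)) with (t - INR n - 1) by ring.
  replace (t + (c - 1)) with (t + c - 1) by ring. reflexivity.
- eapply symbol_cast.
  + apply symbol_mult; [apply symbol_mult; [apply symbol_poch|apply symbol_mult; apply symbol_inv_poch; lra]|].
    apply (symbol_sum p (S n) (- 1 - Z.of_nat (S n)) (fun i t => Xt n c e0 e1 e2 g0 g1 g2 i t)).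
    intros i. apply symbol_Xt.
  + lia.
Qed.

Lemma dlog_1 (k : nat) : dlog 1 k = harm k.
Proof. induction k as [|k IH]; simpl; [reflexivity|]. rewrite IH, (Rplus_comm 1). reflexivity. Qed.

Lemma dlog_S_l (x : R) (k : nat) : dlog x (S k) = / x + dlog (x + 1) k.
Proof.
induction k as [|k IH]; [simpl; rewrite Rplus_0_r; ring|].
change (dlog x (S k) + / (x + INR (S k)) = / x + (dlog (x + 1) k + / (x + 1 + INR k))).
rewrite IH, S_INR. replace (x + (INR k + 1)) with (x + 1 + INR k) by ring. ring.
Qed.

Lemma dlog_neg (n : nat) : dlog (- INR n) n = - harm n.
Proof.
induction n as [|n IH]; [simpl; ring|].
rewrite dlog_S_l, S_INR. replace (- (INR n + 1) + 1) with (- INR n) by ring.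
rewrite IH. simpl. field. apply INR_S_neq_0.
Qed.

Lemma dpoch_dlog_pos (x : R) (k : nat) : 0 < x -> dpoch x k = poch x k * dlog x k.
Proof. intros hx. apply dpoch_dlog. intros i _. generalize (pos_INR i); lra. Qed.

Lemma is_derive_poch_plus (a : R) (k : nat) (t u : R) : t + a = u ->
  is_derive (fun t => poch (t + a) k) t (dpoch u k).
Proof. intros <-. apply is_derive_poch. Qed.

Lemma is_derive_poch_minus (a : R) (k : nat) (t u : R) : t - a = u ->
  is_derive (fun t => poch (t - a) k) t (dpoch u k).
Proof. apply (is_derive_poch_plus (- a)). Qed.

Lemma Derive_2_zero (V : R -> R) (d : Z) :
  symbol 2 d V -> Derive_n (fun t => (t - 1) * V t) 2 1 = 2 * Derive V 1.
Proof.
intros [_ [h1 [_ [h2 _]]]].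
change (Derive (Derive (fun t => (t - 1) * V t)) 1 = 2 * Derive V 1).
rewrite (Derive_ext_loc _ (fun t => V t + (t - 1) * Derive V t)).
- apply is_derive_unique. evar_last.
  + apply @is_derive_plus; [apply Derive_correct, h1; lra|].
    apply (is_derive_mult (fun t => t - 1) (Derive V)); [|apply Derive_correct, h2; lra|intros; apply Rmult_comm].
    auto_derive; [exact I|reflexivity].
  + unfold plus, mult; simpl. ring.
- apply (eq_pos_locally _ (fun t => V t + (t - 1) * Derive V t)); [|lra].
  intros t ht. apply is_derive_unique. evar_last.
  + apply (is_derive_mult (fun t => t - 1) V); [|apply Derive_correct, h1, ht|intros; apply Rmult_comm].
    auto_derive; [exact I|reflexivity].
  + unfold plus, mult; simpl. ring.
Qed.

(** The summand carries a squared binomial. One of the two is consumed by the factorials of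
    [dpoch_neg], and what remains is a term of [hsum]. *)
Lemma bc_fact (n j : nat) : (j <= n)%nat ->
  bc (S n) (S j) * INR (fact j) * INR (fact (n - j)) = INR (fact (S n)) * / (INR j + 1).
Proof.
intros h. rewrite bc_C by lia. unfold Binomial.C. simpl (S n - S j)%nat. rewrite (fact_S j).
field. repeat split; try apply INR_fact_neq_0; apply INR_S_neq_0.
Qed.

(** This is [Xs] divided by its factor t - 1. *)
Definition Us (n k : nat) (c t : R) : R :=
  poch (t - (INR n + 1)) n * / (poch (t + 0) k * poch (t + (c - 1)) (n + 2)).

Lemma is_derive_Us (n k : nat) (c : R) : 0 < c ->
  is_derive (Us n k c) 1 (Us n k c 1 * (- harm n - harm k - dlog c (n + 2))).
Proof.
intros hc. unfold Us.
assert (p1 := poch_pos 1 k ltac:(lra)). assert (p2 := poch_pos c (n + 2) hc).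
evar_last.
- apply (is_derive_mult (fun t => poch (t - (INR n + 1)) n)
    (fun t => / (poch (t + 0) k * poch (t + (c - 1)) (n + 2)))); [| |intros; apply Rmult_comm].
  + apply (is_derive_poch_minus _ _ _ (- INR n)). ring.
  + apply is_derive_inv.
    * apply (is_derive_mult (fun t => poch (t + 0) k) (fun t => poch (t + (c - 1)) (n + 2)));
        [apply (is_derive_poch_plus _ _ _ 1); ring|apply (is_derive_poch_plus _ _ _ c); ring|intros; apply Rmult_comm].
    * rewrite Rplus_0_r. replace (1 + (c - 1)) with c by ring. nra.
- unfold plus, mult; simpl.
  rewrite Rplus_0_r. replace (1 + (c - 1)) with c by ring.
  replace (1 - (INR n + 1)) with (- INR n) by ring.
  rewrite (dpoch_dlog (- INR n)), (dpoch_dlog_pos 1), (dpoch_dlog_pos c), dlog_neg, dlog_1 by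
    (try lra; intros i hi; apply lt_INR in hi; lra).
  field. split; lra.
Qed.

Lemma Xt_1_S (n : nat) (c e0 e1 e2 g0 g1 g2 : R) (j : nat) : (j <= n)%nat ->
  Xt n c e0 e1 e2 g0 g1 g2 (S j) 1 = 0.
Proof.
intros hj. unfold Xt. rewrite S_INR. replace (1 - (INR j + 1)) with (- INR j) by ring.
rewrite (poch_neg_0 j (S n)) by lia. ring.
Qed.

Lemma is_derive_Xt (n : nat) (c e0 e1 e2 g0 g1 g2 : R) (i : nat) :
  is_derive (Xt n c e0 e1 e2 g0 g1 g2 i) 1
    (bc (S n) i ^ 2 * poch (c + INR i) (n - 1)
     * ((g0 + g1 * INR i + g2 * INR i ^ 2) * poch (1 - INR i) (S n)
        + (e0 + e1 * INR i + e2 * INR i ^ 2) * dpoch (1 - INR i) (S n))).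
Proof.
unfold Xt. evar_last.
- apply (is_derive_mult (fun t => bc (S n) i ^ 2
    * (e0 + e1 * INR i + e2 * INR i ^ 2 + (t - 1) * (g0 + g1 * INR i + g2 * INR i ^ 2))
    * poch (c + INR i) (n - 1)) (fun t => poch (t - INR i) (S n)));
    [|apply (is_derive_poch_minus _ _ _ (1 - INR i)); reflexivity|intros; apply Rmult_comm].
  auto_derive; [exact I|reflexivity].
- unfold plus, mult; cbn -[pow poch dpoch bc INR]. ring.
Qed.

Lemma sum_Xt_1 (n : nat) (c e0 e1 e2 g0 g1 g2 : R) :
  sum_f_R0 (fun i => Xt n c e0 e1 e2 g0 g1 g2 i 1) (S n)
  = e0 * poch c (n - 1) * INR (fact (S n)).
Proof.
rewrite decomp_sum by lia. simpl pred.
rewrite (sum_eq _ (fun _ => 0)) by (intros; apply Xt_1_S; assumption).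
rewrite sum_cte. unfold Xt. rewrite bc_n_0. simpl (INR 0).
rewrite Rminus_0_r, poch_1, Rplus_0_r. ring.
Qed.

(** At t = 1 the terms with i >= 1 have a zero from [poch (t - i) (n + 1)]; their derivatives form
    an [hsum] and give one copy of the harmonic number. The other copy is the derivative of the
    Pochhammer symbol in the term i = 0. *)
Lemma is_derive_sum_Xt (n : nat) (c e0 e1 e2 g0 g1 g2 : R) : (1 <= n)%nat ->
  is_derive (fun t => sum_f_R0 (fun i => Xt n c e0 e1 e2 g0 g1 g2 i t) (S n)) 1
    (INR (fact (S n)) * ((g0 + e1) * poch c (n - 1) + e0 * dpoch c (n - 1)
       + 2 * e0 * poch c (n - 1) * harm (S n))).
Proof.
intros hn. evar_last.
- apply is_derive_sum_f_R0. intros i _. apply is_derive_Xt.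
- rewrite decomp_sum by lia. simpl pred.
  rewrite (sum_eq _ (fun j => ((-1) ^ S j * bc (S n) (S j)
     * ((e0 + e1 * INR (S j) + e2 * INR (S j) ^ 2) * poch (c + INR (S j)) (n - 1))
     * / (INR j + 1)) * - INR (fact (S n)))).
  + rewrite <- scal_sum.
    assert (h := hsum_quad n c e0 e1 e2 (n - 1) ltac:(lia)). unfold hsum in h. rewrite h.
    rewrite bc_n_0. simpl (INR 0). rewrite !Rminus_0_r, Rplus_0_r, (dpoch_dlog_pos 1), dlog_1, poch_1 by lra.
    ring.
  + intros j hj.
    assert (e : 1 - INR (S j) = - INR j) by (rewrite S_INR; ring). rewrite e.
    rewrite (poch_neg_0 j (S n)) by lia.
    replace (dpoch (- INR j) (S n)) with (dpoch (- INR j) (j + S (n - j))) by (f_equal; lia).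
    rewrite dpoch_neg.
    transitivity ((-1) ^ j * bc (S n) (S j)
     * ((e0 + e1 * INR (S j) + e2 * INR (S j) ^ 2) * poch (c + INR (S j)) (n - 1))
     * (bc (S n) (S j) * INR (fact j) * INR (fact (n - j)))); [ring|].
    rewrite (bc_fact n j hj). change ((-1) ^ S j) with (-1 * (-1) ^ j). ring.
Qed.

(* X(t) has only a simple zero at t = 1, so that its second derivative vanishes there for a
   non-obvious reason: the harmonic numbers coming from the logarithmic derivative of [Us] cancel
   against those produced by [hsum_quad]. *)
Lemma Derive_2_Xf (n k : nat) (c e0 e1 e2 g0 g1 g2 : R) : 1 <= c -> (1 <= n)%nat ->
  e0 * (2 * harm (S n) - harm n - harm k
        - / (c + INR n - 1) - / (c + INR n) - / (c + INR n + 1)) + e1 + g0 = 0 ->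
  Derive_n (Xf n k c e0 e1 e2 g0 g1 g2) 2 1 = 0.
Proof.
intros hc hn H.
set (S0 := fun t => sum_f_R0 (fun i => Xt n c e0 e1 e2 g0 g1 g2 i t) (S n)).
rewrite (Derive_n_ext (Xf n k c e0 e1 e2 g0 g1 g2) (fun t => (t - 1) * (Us n k c t * S0 t))).
2:{ intros t. unfold Xf, Xs, Us, S0, Rdiv. 
    replace (t - INR n - 1) with (t - (INR n + 1)) by ring.
    replace (t + c - 1) with (t + (c - 1)) by ring. rewrite Rplus_0_r.
    cbn [poch]. ring. }
assert (hsym : symbol 2 (Z.of_nat k - Z.of_nat n) (fun t => Us n k c t * S0 t)).
{ eapply symbol_cast.
  - apply symbol_mult.
    + unfold Us. apply symbol_mult; [apply (symbol_poch 2 n (- (INR n + 1)))|].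
      apply (symbol_ext 2 _ (fun t => / poch (t + 0) k * / poch (t + (c - 1)) (n + 2)));
        [intros; symmetry; apply Rinv_mult|].
      apply symbol_mult; apply symbol_inv_poch; lra.
    + apply (symbol_sum 2 (S n) (- 1 - Z.of_nat (S n)) (fun i t => Xt n c e0 e1 e2 g0 g1 g2 i t)).
      intros i. apply symbol_Xt.
  - lia. }
rewrite (Derive_2_zero _ _ hsym).
replace (Derive (fun t => Us n k c t * S0 t) 1) with 0; [ring|].
symmetry. apply is_derive_unique. evar_last.
- apply (is_derive_mult (Us n k c) S0); [apply is_derive_Us; lra|apply is_derive_sum_Xt; exact hn|intros; apply Rmult_comm].
- match goal with |- plus (mult ?a ?b) (mult ?c ?d) = _ => change (a * b + c * d = 0) end.
  unfold S0. rewrite sum_Xt_1, dpoch_dlog_pos by lra.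
  (* The logarithmic derivatives of [poch c (n + 2)] in [Us] and of [poch c (n - 1)] differ by three
     reciprocals, those of the hypothesis. *)
  destruct n as [|n]; [lia|]. replace (S n - 1)%nat with n by lia.
  replace (S n + 2)%nat with (S (S (S n))) by lia. cbn [dlog].
  match goal with |- ?L = 0 => transitivity (Us (S n) k c 1 * INR (fact (S (S n))) * poch c n * 
   (e0 * (2 * harm (S (S n)) - harm (S n) - harm k
        - / (c + INR (S n) - 1) - / (c + INR (S n)) - / (c + INR (S n) + 1)) + e1 + g0)) end.
  + rewrite !S_INR. replace (c + (INR n + 1) - 1) with (c + INR n) by ring.
    replace (c + (INR n + 1) + 1) with (c + (INR n + 1 + 1)) by ring. 
change (harm (S (S n))) with (harm (S n) + / (INR (S n) + 1)). rewrite !S_INR. ring.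
  + rewrite H. ring.
Qed.

(** * Relations for the double sum *)

(* The polynomials below were found by solving the linear system of creative telescoping for
   A F(m+1) + B F(m) + C F(m-1) = (X(t+1) - X(t)) + (Y(j+1) - Y(j)), where l = n - m and F is
   the summand of the double sum; [cA], [cB], [cC] are the coefficients of the recurrence,
   [xe0], [xe1], [xe2] give X, and [yy] gives Y. *)
Definition cA (n l : R) := - ((n - l + 1) * (n + l) ^ 3 * (3 * n + l + 1)).
Definition cB (n l : R) := (2*n+2*l+1)*(3*n^4+6*n^3-4*n^2*l^2+4*n^2-4*n*l^3-4*n*l^2-2*n*l+n-l^4-2*l^3-2*l^2-l).
Definition cC (n l : R) := (n + l + 1) ^ 5.
Definition xe0 (n l : R) := (n+1)^2*(n+l-1)*(n+l)*(n+l+1)*(2*n^2+3*n+l+1).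
Definition xe1 (n l : R) := (n+1)*(2*n^5+9*n^4-6*n^3*l^2+13*n^3*l+12*n^3-4*n^2*l^3-3*n^2*l^2+25*n^2*l
  +4*n^2-9*n*l^3+12*n*l^2+13*n*l-2*n-2*l^4+l^3+5*l^2+l-1).
Definition xe2 (n l : R) := -n^5-5*n^4*l+n^4-3*n^3*l^2-12*n^3*l+7*n^3+n^2*l^3-13*n^2*l^2-7*n^2*l+9*n^2
  -2*n*l^3-10*n*l^2+5*n-2*l^3-2*l^2+l+1.
Definition yy (n l t j : R) :=
  (n+1)*(n+l+1)*(- l*n*(n+l)*(n+l+1)*(2*n^2+3*n+l+1)
   - (2*n^5+8*n^4*l+5*n^4+8*n^3*l^2+15*n^3*l+4*n^3+2*n^2*l^3+14*n^2*l^2+8*n^2*l+n^2+7*n*l^3+2*n*l^2+n*l+l^4-l^2)*j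
   - (4*n^4+5*n^3*l+7*n^3+9*n^2*l+4*n^2-n*l^3+5*n*l^2+n*l+n+l^3-l)*j^2)
  + t*(- l*(n+l)*(n+l+1)*(2*n^4+2*n^3*l+5*n^3+8*n^2*l+4*n^2+n*l^2+8*n*l+n+2*l^2+2*l)
   - (2*n^6+12*n^5*l+7*n^5+18*n^4*l^2+41*n^4*l+9*n^4+8*n^3*l^3+65*n^3*l^2+51*n^3*l+5*n^3+35*n^2*l^3
      +78*n^2*l^2+27*n^2*l+n^2+4*n*l^4+41*n*l^3+36*n*l^2+5*n*l+7*l^4+12*l^3+5*l^2)*j
   - (5*n^5+9*n^4*l+15*n^4+3*n^3*l^2+32*n^3*l+16*n^3-n^2*l^3+19*n^2*l^2+38*n^2*l+7*n^2+2*n*l^3+25*n*l^2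
      +18*n*l+n+5*l^3+8*l^2+3*l)*j^2).
(** The relation between summands after division by their common Pochhammer factors; (j+1)^2 clears
    the ratio of [bc (n + 1) (j + 1)] to [bc n j], squared. *)
Lemma term_rel_m (n l t j : R) :
  (n + 1) * (j+1)^2 * (cA n l * (t+n+l)*(t+n+l+1)*(l+j)*(l+j+1) + cB n l*(l+j+n)*(l+j+1)*(t+l-1)*(t+n+l+1)
     + cC n l *(t+l)*(t+l-1)*(l+j+n)*(l+j+n+1))
  = (xe0 n l + xe1 n l * (j+1) + xe2 n l * (j+1)^2) * (l+j+1)
      * (t^2*(t+l-1)*(t-j+n) - (t-n-1)*(t+n)*(t+n+l+1)*(t-j-1))
    + yy n l t (j+1) * (t-j-1)*(n-j)^2*(l+j+n) - yy n l t j * (t-j+n)*(j+1)^2*(l+j+1).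
Proof. unfold cA,cB,cC,xe0,xe1,xe2,yy. ring. Qed.
(** The lower end of the telescoping in j: Y(0) compensates the term i = 0 of X, which the
    substitution i = j + 1 misses. *)
Lemma term_rel_m_0 (n l t : R) :
  xe0 n l * l * (t^2*(t+l-1)*(t+n+1) - (t-n-1)*(t+n)*(t+n+l+1)*t)
   + (n+1)^2*yy n l t 0 * t * (l + n - 1) = 0.
Proof. unfold xe0,yy. ring. Qed.

(* [Tf n l] is n! times the second rational function of the theorem for m = n - l.  Keeping l
   real makes the value l = n + 1, i.e. m = -1, available. *)
Definition Qf (n : nat) (l t : R) : R :=
  poch (t - INR n) n / (poch t (S n) * poch (t + l) (S n)).

(** The factor [poch (l + j + 1) n] is n! times the binomial coefficient (n+l+j choose n), written
    as a polynomial in l. *)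
Definition Tt (n : nat) (l : R) (j : nat) (t : R) : R :=
  bc n j ^ 2 * poch (l + INR j + 1) n * poch (t - INR j) n.

Definition Tf (n : nat) (l t : R) : R := Qf n l t * sum_f_R0 (fun j => Tt n l j t) n.

Lemma symbol_Tf (k n : nat) (l : R) : 0 <= l -> symbol k 2 (Tf n l).
Proof.
intros hl. unfold Tf.
apply (symbol_ext k _ (fun t => (poch (t + - INR n) n * (/ poch (t + 0) (S n) * / poch (t + l) (S n)))
   * sum_f_R0 (fun j => Tt n l j t) n)).
- intros t _. unfold Qf, Rdiv. rewrite Rinv_mult, Rplus_0_r. reflexivity.
- eapply symbol_cast.
  + apply symbol_mult; [apply symbol_mult; [apply symbol_poch|apply symbol_mult; apply symbol_inv_poch; lra]|].
    apply (symbol_sum k n (0 + - Z.of_nat n) (fun j => Tt n l j)).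
    intros j. unfold Tt. apply (symbol_mult k 0 _ (fun _ => _)); [apply symbol_const|apply (symbol_poch k n (- INR j))].
  + lia.
Qed.

Lemma sum_telescope (Y : nat -> R) (n : nat) :
  sum_f_R0 (fun j => Y (S j) - Y j) n = Y (S n) - Y 0%nat.
Proof. induction n as [|n IH]; simpl; [reflexivity|]. rewrite IH; ring. Qed.

Lemma sum_Xt_ext (n N : nat) (c e0 e1 e2 g0 g1 g2 t : R) : (n <= N)%nat ->
  sum_f_R0 (fun i => Xt n c e0 e1 e2 g0 g1 g2 i t) (S n)
  = Xt n c e0 e1 e2 g0 g1 g2 0 t + sum_f_R0 (fun j => Xt n c e0 e1 e2 g0 g1 g2 (S j) t) N.
Proof.
intros hN. rewrite decomp_sum by lia. simpl pred. f_equal.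
induction hN as [|N hN IH]; [reflexivity|]. rewrite tech5, <- IH.
replace (Xt n c e0 e1 e2 g0 g1 g2 (S (S N)) t) with 0; [ring|].
unfold Xt. rewrite bc_0 by lia. ring.
Qed.

(** Creative telescoping assembled once for all certificates: summing over j collapses Y, whose
    value at 0 supplies the missing term i = 0. N may exceed n, since the summand for n + 1 has one
    more term. *)
Lemma Xf_diff (n k : nat) (c e0 e1 e2 g0 g1 g2 t : R) (F Y : nat -> R) (N : nat) :
  (n <= N)%nat ->
  (forall j, (j <= N)%nat ->
     F j = Xs n k c (t + 1) * Xt n c e0 e1 e2 g0 g1 g2 (S j) (t + 1)
           - Xs n k c t * Xt n c e0 e1 e2 g0 g1 g2 (S j) t + (Y (S j) - Y j)) ->
  Y 0%nat = - (Xs n k c (t + 1) * Xt n c e0 e1 e2 g0 g1 g2 0 (t + 1)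
           - Xs n k c t * Xt n c e0 e1 e2 g0 g1 g2 0 t) ->
  Y (S N) = 0 ->
  sum_f_R0 F N = Xf n k c e0 e1 e2 g0 g1 g2 (t + 1) - Xf n k c e0 e1 e2 g0 g1 g2 t.
Proof.
intros hN hF h0 h1.
rewrite (sum_eq _ _ _ hF), sum_plus, sum_telescope, h0, h1. unfold Xf.
rewrite !(sum_Xt_ext n N) by exact hN.
rewrite minus_sum.
rewrite (sum_eq (fun j => Xs n k c (t + 1) * Xt n c e0 e1 e2 g0 g1 g2 (S j) (t + 1))
  (fun j => Xt n c e0 e1 e2 g0 g1 g2 (S j) (t + 1) * Xs n k c (t + 1))) by (intros; ring).
rewrite (sum_eq (fun j => Xs n k c t * Xt n c e0 e1 e2 g0 g1 g2 (S j) t)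
  (fun j => Xt n c e0 e1 e2 g0 g1 g2 (S j) t * Xs n k c t)) by (intros; ring).
rewrite <- !scal_sum. ring.
Qed.

Lemma poch_shift (x : R) (k : nat) : x <> 0 -> poch (x + 1) k = poch x k * (x + INR k) / x.
Proof.
intros hx. apply (Rmult_eq_reg_l x); [|exact hx]. rewrite <- poch_S_l. simpl. field. exact hx.
Qed.

Lemma INR_1_le (m : nat) : 1 <= INR (S m).
Proof. apply (le_INR 1); lia. Qed.

(** In the factor (n+1)^3, two powers come from [bc (n + 1) (j + 1)] = (n+1)/(j+1) [bc n j] squared,
    the third from [term_rel_m]. *)
Lemma Tf_rel_m (n : nat) (l t : R) : (1 <= n)%nat -> 1 <= l -> 0 < t ->
  (INR n + 1) ^ 3 * cA (INR n) l * Tf n (l - 1) t + (INR n + 1) ^ 3 * cB (INR n) l * Tf n l t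
    + (INR n + 1) ^ 3 * cC (INR n) l * Tf n (l + 1) t
  = Xf n n l (xe0 (INR n) l) (xe1 (INR n) l) (xe2 (INR n) l) 0 0 0 (t + 1)
    - Xf n n l (xe0 (INR n) l) (xe1 (INR n) l) (xe2 (INR n) l) 0 0 0 t.
Proof.
(* From here on [m] stands for n - 1, so that the truncated [n - 1] in [Xt] is a variable. *)
intros hn hl ht. destruct n as [|m]; [lia|]. clear hn.
assert (hn := INR_1_le m). remember (INR (S m)) as n eqn:En.
assert (Em : INR m = n - 1) by (rewrite En, S_INR; ring).
set (q := Qf (S m) l t).
assert (p1 := poch_pos t (S (S m)) ht).
assert (p2 := poch_pos (t + l) (S (S m)) ltac:(lra)).
assert (q1 : Qf (S m) (l - 1) t = q * (t + n + l) / (t + l - 1)).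
{ unfold q, Qf. rewrite <- En.
  assert (p3 := poch_pos (t + (l - 1)) (S (S m)) ltac:(lra)).
  replace (t + l) with (t + (l - 1) + 1) by ring.
  rewrite (poch_shift (t + (l - 1))) by lra. rewrite (S_INR (S m)), <- En.
  field. repeat split; lra. }
assert (q2 : Qf (S m) (l + 1) t = q * (t + l) / (t + n + l + 1)).
{ unfold q, Qf. rewrite <- En. replace (t + (l + 1)) with (t + l + 1) by ring.
  rewrite (poch_shift (t + l)) by lra. rewrite (S_INR (S m)), <- En.
  field. repeat split; lra. }
assert (x1 : Xs (S m) (S m) l (t + 1) = q * t ^ 2 / (t + n + l + 1)).
{ unfold q, Xs, Qf. rewrite <- En.
  replace (t + 1 - n - 1) with (t - n) by ring. replace (t + 1 + l - 1) with (t + l) by ring.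
  rewrite (poch_shift t) by lra. 
  replace (S m + 2)%nat with (S (S (S m))) by lia.
  change (poch (t + l) (S (S (S m)))) with (poch (t + l) (S (S m)) * (t + l + INR (S (S m)))).
  assert (p4 := poch_pos t (S m) ht).
  change (poch t (S (S m))) with (poch t (S m) * (t + INR (S m))).
  change (poch (t - n) (S (S m))) with (poch (t - n) (S m) * (t - n + INR (S m))).
  rewrite (S_INR (S m)), <- En. field. repeat split; lra. }
assert (x2 : Xs (S m) (S m) l t = q * (t - n - 1) * (t + n) / (t + l - 1)).
{ unfold q, Xs, Qf. rewrite <- En.
  rewrite (poch_S_l (t - n - 1)). replace (t - n - 1 + 1) with (t - n) by ring.
  replace (S m + 2)%nat with (S (S (S m))) by lia.
  rewrite (poch_S_l (t + l - 1)). replace (t + l - 1 + 1) with (t + l) by ring.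
  assert (p4 := poch_pos t (S m) ht).
  change (poch t (S (S m))) with (poch t (S m) * (t + INR (S m))).
  rewrite <- En. field. repeat split; lra. }
unfold Tf at 1 2 3. rewrite q1, q2. fold q.
transitivity (sum_f_R0 (fun j => (n + 1) ^ 3 * q *
   (cA n l * (t + n + l) / (t + l - 1) * Tt (S m) (l - 1) j t + cB n l * Tt (S m) l j t
    + cC n l * (t + l) / (t + n + l + 1) * Tt (S m) (l + 1) j t)) (S m)).
{ transitivity (sum_f_R0 (fun j => Tt (S m) (l - 1) j t * ((n + 1) ^ 3 * q * (cA n l * (t + n + l) / (t + l - 1)))
     + Tt (S m) l j t * ((n + 1) ^ 3 * q * cB n l)
     + Tt (S m) (l + 1) j t * ((n + 1) ^ 3 * q * (cC n l * (t + l) / (t + n + l + 1)))) (S m)).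
  - rewrite !sum_plus, <- !scal_sum. field. split; lra.
  - apply sum_eq; intros; ring. }
(* The binomial in Y vanishes at j = n + 1, which closes the telescoping at its upper end. *)
apply (Xf_diff (S m) (S m) l _ _ _ _ _ _ t _
  (fun j => (n + 1) ^ 2 * q * yy n l t (INR j) * poch (t - INR j) (S (S m)) * bc (S m) j ^ 2
     * poch (l + INR j + 1) m / ((t + l - 1) * (t + n + l + 1)))); [lia| | |].
- intros j hj. rewrite x1, x2. unfold Tt, Xt. 
  replace (S m - 1)%nat with m by lia.
  assert (hj0 := pos_INR j).
  assert (b1 : bc (S m) (S j) = (n - INR j) * bc (S m) j / (INR j + 1)).
  { rewrite En, <- bc_S_r. field. lra. }
  assert (b2 : bc (S (S m)) (S j) = (n + 1) * bc (S m) j / (INR j + 1)).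
  { rewrite En, <- bc_S_S. field. lra. }
  rewrite b1, b2, (S_INR j).
  set (x := INR j) in *. set (b := bc (S m) j).
  replace (l - 1 + x + 1) with (l + x) by ring.
  replace (l + 1 + x + 1) with (l + x + 1 + 1) by ring.
  replace (l + (x + 1)) with (l + x + 1) by ring.
  rewrite (poch_S_l (l + x) m).
  rewrite !(poch_shift (l + x + 1)) by lra.
  change (poch (l + x + 1) (S m)) with (poch (l + x + 1) m * (l + x + 1 + INR m)).
  replace (t + 1 - (x + 1)) with (t - x) by ring.
  rewrite (poch_S_l (t - (x + 1))). replace (t - (x + 1) + 1) with (t - x) by ring.
  change (poch (t - x) (S (S m))) with (poch (t - x) (S m) * (t - x + INR (S m))).
  rewrite <- En, Em.
  set (p := poch (t - x) (S m)). set (w := poch (l + x + 1) m).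
  assert (T := term_rel_m n l t x).
  match goal with |- ?L = ?R => 
    apply (Rmult_eq_reg_r ((t + l - 1) * (t + n + l + 1) * (l + x + 1) * (x + 1) ^ 2)) end.
  2:{ repeat apply Rmult_integral_contrapositive_currified; lra. }
  transitivity ((n + 1) ^ 2 * q * b ^ 2 * w * p * ((n + 1) * (x+1)^2 * (cA n l * (t+n+l)*(t+n+l+1)*(l+x)*(l+x+1) + cB n l*(l+x+n)*(l+x+1)*(t+l-1)*(t+n+l+1)
     + cC n l *(t+l)*(t+l-1)*(l+x+n)*(l+x+n+1)))).
  { field. repeat split; lra. }
  rewrite T. field. repeat split; lra.
- rewrite x1, x2. unfold Xt. simpl (INR 0). rewrite !bc_n_0.
  replace (S m - 1)%nat with m by lia.
  replace (l + 0 + 1) with (l + 1) by ring. rewrite !Rminus_0_r, Rplus_0_r.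
  rewrite (poch_shift l) by lra.
  rewrite (poch_S_l t). 
  change (poch (t + 1) (S (S m))) with (poch (t + 1) (S m) * (t + 1 + INR (S m))).
  rewrite Em, <- En. assert (T := term_rel_m_0 n l t).
  match goal with |- ?L = ?R => apply Rminus_diag_uniq;
   transitivity (q * poch (t + 1) (S m) * poch l m / ((t + l - 1) * (t + n + l + 1) * l) *
    (xe0 n l * l * (t^2*(t+l-1)*(t+n+1) - (t-n-1)*(t+n)*(t+n+l+1)*t)
   + (n+1)^2*yy n l t 0 * t * (l + n - 1))) end.
  + field. repeat split; lra.
  + rewrite T. ring.
- rewrite bc_0 by lia. field. split; lra.
Qed.

(* Certificates for the relation between (n+1,0), (n,0), (n,-1) and, below, between (n+1,-1) and
   (n,-1), where (n,-1) stands for l = n + 1 in [Tf]. *)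
Definition cR (n : R) := 5460*n^4+13499*n^3+12601*n^2+5265*n+831.
Definition ue0 (n : R) := - ((n+1)^4*n*(2*n+1)*(1380*n+868)).
Definition ue1 (n : R) := (n+1)^3*(2760*n^4+4496*n^3+356*n^2-1558*n-434).
Definition ue2 (n : R) := (n+1)*(-2760*n^5-1848*n^4+3645*n^3+4773*n^2+1873*n+217).
(** There is no separate constant coefficient for the part multiplied by t - 1: it coincides with
    [ue0]. *)
Definition ug1 (n : R) := (n+1)^2*(4140*n^4+5490*n^3+560*n^2-1480*n-434).
Definition ug2 (n : R) := 1380*n^5+7790*n^4+13313*n^3+10145*n^2+3587*n+473.
Definition uy (n t j : R) :=
  (n+1)^3*j*((n+1)^2*(512+2196*n+2196*n^2-1736*n^3-2760*n^4)
    + (n+1)*(-1024-4264*n-4060*n^2+3676*n^3+5520*n^4)*j + (512+2116*n+1984*n^2-1868*n^3-2760*n^4)*j^2)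
  + t*(n+1)^2*((n+2)*(n+1)^3*(2*n+1)^2*(690*n+434) - (n+1)^3*(2*n+1)*(3450*n^2+2578*n+256)*j
    + (n+1)*(5520*n^4+964*n^3-10658*n^2-8834*n-1964)*j^2 + (-1380*n^4+4526*n^3+11008*n^2+7014*n+1400)*j^3)
  + t^2*(n+1)*((n+2)*(n+1)^3*(2*n+1)^2*(690*n+434) - (n+1)^2*(2*n+3)*(2070*n^3+3090*n^2+1532*n+256)*j
    - (n+1)*(5472*n^3+10122*n^2+6102*n+1196)*j^2 + (1380*n^4+7774*n^3+10846*n^2+5756*n+1048)*j^3).
Lemma term_rel_n (n t j : R) :
  (j+1)^2 * (16*(n+1)^6*(t-n-1)*(t+n)*(t-j+n)*(2*n+1+j)*(2*n+2+j)
     + 256*(n+1)*(2*n+1)^4*(n+1-j)^2*(n+1+j)*(t+n+1)*(t+2*n+1)*(t+2*n+2)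
     - (n+1)*cR n*(n+1-j)^2*(2*n+1+j)*(t+n+1)*(t+n)*(t+2*n+2))
  = (n+1-j)^2*((ue0 n + ue1 n*(j+1) + ue2 n*(j+1)^2 + t*(ue0 n + ug1 n*(j+1) + ug2 n*(j+1)^2))*t^2*(t+n)*(t-j+n)
       - (ue0 n + ue1 n*(j+1) + ue2 n*(j+1)^2 + (t-1)*(ue0 n + ug1 n*(j+1) + ug2 n*(j+1)^2))
          *(t-n-1)*(t+n+1)*(t+2*n+2)*(t-j-1))
    + uy n t (j+1)*(t-j-1)*(n+1-j)^2*(2*n+1+j) - uy n t j*(t-j+n)*(n+1+j)*(j+1)^2.
Proof. unfold cR,ue0,ue1,ue2,ug1,ug2,uy. ring. Qed.
Lemma term_rel_n_0 (n t : R) :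
  (ue0 n + t*ue0 n)*t^2*(t+n)*(t+n+1) - (ue0 n+(t-1)*ue0 n)*(t-n-1)*(t+n+1)*(t+2*n+2)*t
  + uy n t 0*t*(2*n) = 0.
Proof. unfold ue0,uy. ring. Qed.

Definition ve0 (n : R) := - ((n+1)^2*(2*n+3)*(2*n+1)*(120*n^2+326*n+222)).
Definition ve1 (n : R) := - ((n+1)*(1152*n^4+5160*n^3+8514*n^2+6095*n+1581)).
Definition ve2 (n : R) := - ((n+1)*(4*n+5)*(40*n^2+190*n+183)).
Definition vg0 (n : R) := (n+1)*(2*n+1)*(456*n^3+1786*n^2+2340*n+1026).
Definition vg1 (n : R) := 288*n^4+1740*n^3+3681*n^2+3278*n+1041.
Definition vg2 (n : R) := (n+1)*(4*n+5)*(4*n+3).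
Definition vy (n t j : R) :=
  (n+1)^2*(2*n+3)*((n+1)*(240*n^4+1708*n^3+4220*n^2+4428*n+1692) + (3*n+4)*(192*n^3+632*n^2+720*n+288)*j
     - (240*n^3+772*n^2+792*n+252)*j^2)
  - 36*t*(n+1)^3*(3*n+4)*(4*n+5)*(n+1-j)^2
  + t^2*(- (n+1)*(912*n^5+6548*n^4+18928*n^3+27456*n^2+19944*n+5796)
     - (3*n+4)*(96*n^4+616*n^3+1392*n^2+1368*n+504)*j + (48*n^4+284*n^3+516*n^2+324*n+36)*j^2).
Lemma term_rel_rho (n t j : R) :
  (j+1)^2 * (8*(2*n+3)^5*(t-n-1)*(t+n+1)*(t-j+n)*(2*n+2+j)*(2*n+3+j)
     + (n+1)^2*(4*n+5)*(4*n+3)*(n+1-j)^2*(n+2+j)*(t+n+1)*(t+2*n+2)*(t+2*n+3))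
  = (n+1-j)^2*((ve0 n + ve1 n*(j+1) + ve2 n*(j+1)^2 + t*(vg0 n + vg1 n*(j+1) + vg2 n*(j+1)^2))*t^2*(t+n+1)*(t-j+n)
       - (ve0 n + ve1 n*(j+1) + ve2 n*(j+1)^2 + (t-1)*(vg0 n + vg1 n*(j+1) + vg2 n*(j+1)^2))
          *(t-n-1)*(t+n+1)*(t+2*n+3)*(t-j-1))
    + vy n t (j+1)*(t-j-1)*(n+1-j)^2*(2*n+2+j) - vy n t j*(t-j+n)*(n+2+j)*(j+1)^2.
Proof. unfold ve0,ve1,ve2,vg0,vg1,vg2,vy. ring. Qed.
Lemma term_rel_rho_0 (n t : R) :
  (ve0 n + t*vg0 n)*t^2*(t+n+1)*(t+n+1) - (ve0 n+(t-1)*vg0 n)*(t-n-1)*(t+n+1)*(t+2*n+3)*t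
  + vy n t 0*t*(2*n+1) = 0.
Proof. unfold ve0,vg0,vy. ring. Qed.

(** Brings the sums for n and for n + 1 to the same range of j. *)
Lemma sum_Tt_S (n : nat) (l t : R) :
  sum_f_R0 (fun j => Tt n l j t) n = sum_f_R0 (fun j => Tt n l j t) (S n).
Proof. rewrite tech5. unfold Tt at 3. rewrite (bc_0 n (S n)) by lia. ring. Qed.

Lemma Tf_rel_rho (n : nat) (t : R) : (1 <= n)%nat -> 0 < t ->
  8 * (2 * INR n + 3) ^ 5 * Tf (S n) (INR n + 2) t
    + (INR n + 1) ^ 4 * (4 * INR n + 5) * (4 * INR n + 3) * Tf n (INR n + 1) t
    + 0 * Tf n (INR n + 1) t
  = Xf n (S n) (INR n + 2) (ve0 (INR n)) (ve1 (INR n)) (ve2 (INR n)) (vg0 (INR n)) (vg1 (INR n)) (vg2 (INR n)) (t + 1)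
    - Xf n (S n) (INR n + 2) (ve0 (INR n)) (ve1 (INR n)) (ve2 (INR n)) (vg0 (INR n)) (vg1 (INR n)) (vg2 (INR n)) t.
Proof.
intros hn ht. destruct n as [|m]; [lia|]. clear hn.
assert (hn := INR_1_le m). remember (INR (S m)) as n eqn:En. symmetry in En.
assert (Em : INR m = n - 1) by (rewrite <- En, S_INR; ring).
assert (E2 : INR (S (S m)) = n + 1) by (rewrite S_INR, En; ring).
assert (E3 : INR (S (S (S m))) = n + 2) by (rewrite S_INR, E2; ring).
set (q := poch (t - n) (S m) / (poch t (S (S (S m))) * poch (t + ((n + 2) - 1)) (S (S (S (S m)))))).
assert (p0 := poch_pos t (S (S (S m))) ht).
assert (p1 := poch_pos t (S (S m)) ht).
assert (p2 := poch_pos (t + (n + 2)) (S (S (S m))) ltac:(lra)).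
assert (p3 := poch_pos (t + ((n + 2) - 1)) (S (S m)) ltac:(lra)).
assert (p4 := poch_pos (t + (n + 2)) (S (S m)) ltac:(lra)).
assert (q1 : Qf (S (S m)) (n + 2) t = q * (t - n - 1) * (t + (n + 2) - 1)).
{ unfold q, Qf. rewrite E2.
  rewrite (poch_S_l (t + ((n + 2) - 1))). replace (t + ((n + 2) - 1) + 1) with (t + (n + 2)) by ring.
  replace (t - (n + 1)) with (t - n - 1) by ring.
  rewrite (poch_S_l (t - n - 1)). replace (t - n - 1 + 1) with (t - n) by ring.
  field. repeat split; lra. }
assert (q2 : Qf (S m) ((n + 2) - 1) t = q * (t + n + 1) * (t + (n + 2) + n) * (t + (n + 2) + n + 1)).
{ unfold q, Qf. rewrite En.
  change (poch t (S (S (S m)))) with (poch t (S (S m)) * (t + INR (S (S m)))).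
  change (poch (t + ((n + 2) - 1)) (S (S (S (S m))))) with
    (poch (t + ((n + 2) - 1)) (S (S m)) * (t + ((n + 2) - 1) + INR (S (S m))) * (t + ((n + 2) - 1) + INR (S (S (S m))))).
  rewrite E2, E3. field. repeat split; lra. }
replace (n + 2 - 1) with (n + 1) in q2 by ring.
assert (x1 : Xs (S m) (S (S m)) (n + 2) (t + 1) = q * t ^ 2 * (t + (n + 2) - 1)).
{ unfold q, Xs. rewrite En.
  replace (t + 1 - n - 1) with (t - n) by ring. replace (t + 1 + (n + 2) - 1) with (t + (n + 2)) by ring.
  rewrite (poch_S_l t (S (S m))).
  rewrite (poch_S_l (t + ((n + 2) - 1))). replace (t + ((n + 2) - 1) + 1) with (t + (n + 2)) by ring.
  assert (p5 := poch_pos (t + 1) (S (S m)) ltac:(lra)).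
  replace (S m + 2)%nat with (S (S (S m))) by lia.
  change (poch (t - n) (S (S m))) with (poch (t - n) (S m) * (t - n + INR (S m))).
  rewrite En. field. repeat split; lra. }
assert (x2 : Xs (S m) (S (S m)) (n + 2) t = q * (t - n - 1) * (t + n + 1) * (t + (n + 2) + n + 1)).
{ unfold q, Xs. rewrite En.
  rewrite (poch_S_l (t - n - 1)). replace (t - n - 1 + 1) with (t - n) by ring.
  replace (S m + 2)%nat with (S (S (S m))) by lia.
  replace (t + (n + 2) - 1) with (t + ((n + 2) - 1)) by ring.
  change (poch t (S (S (S m)))) with (poch t (S (S m)) * (t + INR (S (S m)))).
  change (poch (t + ((n + 2) - 1)) (S (S (S (S m))))) with
    (poch (t + ((n + 2) - 1)) (S (S (S m))) * (t + ((n + 2) - 1) + INR (S (S (S m))))).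
  assert (p5 := poch_pos (t + ((n + 2) - 1)) (S (S (S m))) ltac:(lra)).
  rewrite E2, E3. field. repeat split; lra. }
unfold Tf. rewrite q1, q2. rewrite !(sum_Tt_S (S m)).
transitivity (sum_f_R0 (fun j => q * (t + n + 1) * (8 * (2 * n + 3) ^ 5 * (t - n - 1) * Tt (S (S m)) (n + 2) j t
   + (n + 1) ^ 4 * (4 * n + 5) * (4 * n + 3) * (t + 2 * n + 2) * (t + 2 * n + 3) * Tt (S m) (n + 1) j t)) (S (S m))).
{ transitivity (sum_f_R0 (fun j => Tt (S (S m)) (n + 2) j t * (q * (t + n + 1) * (8 * (2 * n + 3) ^ 5 * (t - n - 1)))
   + Tt (S m) (n + 1) j t * (q * (t + n + 1) * ((n + 1) ^ 4 * (4 * n + 5) * (4 * n + 3) * (t + 2 * n + 2) * (t + 2 * n + 3)))) (S (S m))).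
  - rewrite !sum_plus, <- !scal_sum. ring.
  - apply sum_eq; intros; ring. }
apply (Xf_diff (S m) (S (S m)) (n + 2) _ _ _ _ _ _ t _
  (fun j => q * vy n t (INR j) * poch (t - INR j) (S (S m)) * bc (S (S m)) j ^ 2
     * poch ((n + 2) + INR j) (S m))); [lia| | |].
- intros j hj. rewrite x1, x2. unfold Tt, Xt.
  replace (S m - 1)%nat with m by lia.
  assert (hj0 := pos_INR j).
  assert (b1 : bc (S (S m)) (S j) = (n + 1 - INR j) * bc (S (S m)) j / (INR j + 1)).
  { rewrite <- E2, <- bc_S_r. field. lra. }
  (* Everything is expressed through the binomial of n + 1, because j now runs up to n + 1, where
     that of n vanishes. *)
  assert (b2 : bc (S m) j = (n + 1 - INR j) * bc (S (S m)) j / (n + 1)).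
  { apply (Rmult_eq_reg_l (n + 1)); [|lra]. rewrite <- En at 1. rewrite <- bc_S_l, En. field. lra. }
  rewrite b1, b2, (S_INR j).
  set (x := INR j) in *. set (b := bc (S (S m)) j).
  replace (n + 1 + x + 1) with ((n + 2) + x) by ring.
  replace ((n + 2) + (x + 1)) with ((n + 2) + x + 1) by ring.
  rewrite (poch_S_l ((n + 2) + x) m).
  change (poch ((n + 2) + x + 1) (S (S m))) with (poch ((n + 2) + x + 1) m * ((n + 2) + x + 1 + INR m) * ((n + 2) + x + 1 + INR (S m))).
  change (poch ((n + 2) + x + 1) (S m)) with (poch ((n + 2) + x + 1) m * ((n + 2) + x + 1 + INR m)).
  replace (t + 1 - (x + 1)) with (t - x) by ring.
  rewrite (poch_S_l (t - (x + 1))). replace (t - (x + 1) + 1) with (t - x) by ring.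
  change (poch (t - x) (S (S m))) with (poch (t - x) (S m) * (t - x + INR (S m))).
  rewrite En, Em.
  set (p := poch (t - x) (S m)). set (w := poch ((n + 2) + x + 1) m).
  assert (T := term_rel_rho n t x).
  apply (Rmult_eq_reg_r ((x + 1) ^ 2)); [|apply pow_nonzero; lra].
  match type of T with ?L = _ => transitivity (q * b ^ 2 * w * p * L) end.
  { field. lra. }
  rewrite T. field. lra.
- rewrite x1, x2. unfold Xt. simpl (INR 0). rewrite !bc_n_0.
  replace (S m - 1)%nat with m by lia.
  rewrite !Rminus_0_r, Rplus_0_r.
  change (poch (n + 2) (S m)) with (poch (n + 2) m * ((n + 2) + INR m)).
  rewrite (poch_S_l t (S m)).
  change (poch (t + 1) (S (S m))) with (poch (t + 1) (S m) * (t + 1 + INR (S m))).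
  rewrite Em, En. assert (T := term_rel_rho_0 n t).
  apply Rminus_diag_uniq.
  match type of T with ?L = _ => transitivity (q * poch (t + 1) (S m) * poch (n + 2) m * L) end.
  + ring.
  + rewrite T. ring.
- rewrite bc_0 by lia. ring.
Qed.

Lemma Tf_rel_n (n : nat) (t : R) : (1 <= n)%nat -> 0 < t ->
  16 * (INR n + 1) ^ 6 * Tf (S n) (INR n + 1) t
    + 256 * (INR n + 1) ^ 3 * (2 * INR n + 1) ^ 4 * Tf n (INR n) t
    + - ((INR n + 1) ^ 3 * cR (INR n)) * Tf n (INR n + 1) t
  = Xf n (S n) (INR n + 1) (ue0 (INR n)) (ue1 (INR n)) (ue2 (INR n)) (ue0 (INR n)) (ug1 (INR n)) (ug2 (INR n)) (t + 1)
    - Xf n (S n) (INR n + 1) (ue0 (INR n)) (ue1 (INR n)) (ue2 (INR n)) (ue0 (INR n)) (ug1 (INR n)) (ug2 (INR n)) t.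
Proof.
intros hn ht. destruct n as [|m]; [lia|]. clear hn.
assert (hn := INR_1_le m). remember (INR (S m)) as n eqn:En. symmetry in En.
assert (Em : INR m = n - 1) by (rewrite <- En, S_INR; ring).
assert (E2 : INR (S (S m)) = n + 1) by (rewrite S_INR, En; ring).
assert (E3 : INR (S (S (S m))) = n + 2) by (rewrite S_INR, E2; ring).
set (q := poch (t - n) (S m) / (poch t (S (S (S m))) * poch (t + ((n + 1) - 1)) (S (S (S (S m)))))).
assert (p0 := poch_pos t (S (S (S m))) ht).
assert (p1 := poch_pos t (S (S m)) ht).
assert (p2 := poch_pos (t + (n + 1)) (S (S (S m))) ltac:(lra)).
assert (p3 := poch_pos (t + ((n + 1) - 1)) (S (S m)) ltac:(lra)).
assert (p4 := poch_pos (t + (n + 1)) (S (S m)) ltac:(lra)).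
assert (q1 : Qf (S (S m)) (n + 1) t = q * (t - n - 1) * (t + (n + 1) - 1)).
{ unfold q, Qf. rewrite E2.
  rewrite (poch_S_l (t + ((n + 1) - 1))). replace (t + ((n + 1) - 1) + 1) with (t + (n + 1)) by ring.
  replace (t - (n + 1)) with (t - n - 1) by ring.
  rewrite (poch_S_l (t - n - 1)). replace (t - n - 1 + 1) with (t - n) by ring.
  field. repeat split; lra. }
assert (q2 : Qf (S m) ((n + 1) - 1) t = q * (t + n + 1) * (t + (n + 1) + n) * (t + (n + 1) + n + 1)).
{ unfold q, Qf. rewrite En.
  change (poch t (S (S (S m)))) with (poch t (S (S m)) * (t + INR (S (S m)))).
  change (poch (t + ((n + 1) - 1)) (S (S (S (S m))))) with
    (poch (t + ((n + 1) - 1)) (S (S m)) * (t + ((n + 1) - 1) + INR (S (S m))) * (t + ((n + 1) - 1) + INR (S (S (S m))))).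
  rewrite E2, E3. field. repeat split; lra. }
replace (n + 1 - 1) with n in q2 by ring.
assert (q3 : Qf (S m) (n + 1) t = q * (t + n + 1) * (t + (n + 1) - 1) * (t + (n + 1) + n + 1)).
{ unfold q, Qf. rewrite En.
  rewrite (poch_S_l (t + ((n + 1) - 1))). replace (t + ((n + 1) - 1) + 1) with (t + (n + 1)) by ring.
  change (poch t (S (S (S m)))) with (poch t (S (S m)) * (t + INR (S (S m)))).
  change (poch (t + (n + 1)) (S (S (S m)))) with (poch (t + (n + 1)) (S (S m)) * (t + (n + 1) + INR (S (S m)))).
  rewrite E2. field. repeat split; lra. }

assert (x1 : Xs (S m) (S (S m)) (n + 1) (t + 1) = q * t ^ 2 * (t + (n + 1) - 1)).
{ unfold q, Xs. rewrite En.
  replace (t + 1 - n - 1) with (t - n) by ring. replace (t + 1 + (n + 1) - 1) with (t + (n + 1)) by ring.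
  rewrite (poch_S_l t (S (S m))).
  rewrite (poch_S_l (t + ((n + 1) - 1))). replace (t + ((n + 1) - 1) + 1) with (t + (n + 1)) by ring.
  assert (p5 := poch_pos (t + 1) (S (S m)) ltac:(lra)).
  replace (S m + 2)%nat with (S (S (S m))) by lia.
  change (poch (t - n) (S (S m))) with (poch (t - n) (S m) * (t - n + INR (S m))).
  rewrite En. field. repeat split; lra. }
assert (x2 : Xs (S m) (S (S m)) (n + 1) t = q * (t - n - 1) * (t + n + 1) * (t + (n + 1) + n + 1)).
{ unfold q, Xs. rewrite En.
  rewrite (poch_S_l (t - n - 1)). replace (t - n - 1 + 1) with (t - n) by ring.
  replace (S m + 2)%nat with (S (S (S m))) by lia.
  replace (t + (n + 1) - 1) with (t + ((n + 1) - 1)) by ring.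
  change (poch t (S (S (S m)))) with (poch t (S (S m)) * (t + INR (S (S m)))).
  change (poch (t + ((n + 1) - 1)) (S (S (S (S m))))) with
    (poch (t + ((n + 1) - 1)) (S (S (S m))) * (t + ((n + 1) - 1) + INR (S (S (S m))))).
  assert (p5 := poch_pos (t + ((n + 1) - 1)) (S (S (S m))) ltac:(lra)).
  rewrite E2, E3. field. repeat split; lra. }
unfold Tf. rewrite q1, q2, q3. rewrite !(sum_Tt_S (S m)).
transitivity (sum_f_R0 (fun j => q * (16 * (n + 1) ^ 6 * (t - n - 1) * (t + n) * Tt (S (S m)) (n + 1) j t
   + 256 * (n + 1) ^ 3 * (2 * n + 1) ^ 4 * (t + n + 1) * (t + 2 * n + 1) * (t + 2 * n + 2) * Tt (S m) n j t
   - (n + 1) ^ 3 * cR n * (t + n + 1) * (t + n) * (t + 2 * n + 2) * Tt (S m) (n + 1) j t)) (S (S m))).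
{ transitivity (sum_f_R0 (fun j => Tt (S (S m)) (n + 1) j t * (q * (16 * (n + 1) ^ 6 * (t - n - 1) * (t + n)))
   + Tt (S m) n j t * (q * (256 * (n + 1) ^ 3 * (2 * n + 1) ^ 4 * (t + n + 1) * (t + 2 * n + 1) * (t + 2 * n + 2)))
   + Tt (S m) (n + 1) j t * (q * - ((n + 1) ^ 3 * cR n * (t + n + 1) * (t + n) * (t + 2 * n + 2)))) (S (S m))).
  - rewrite !sum_plus, <- !scal_sum. ring.
  - apply sum_eq; intros; ring. }
apply (Xf_diff (S m) (S (S m)) (n + 1) _ _ _ _ _ _ t _
  (fun j => q * uy n t (INR j) * poch (t - INR j) (S (S m)) * bc (S (S m)) j ^ 2
     * poch ((n + 1) + INR j) (S m))); [lia| | |].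
- intros j hj. rewrite x1, x2. unfold Tt, Xt.
  replace (S m - 1)%nat with m by lia.
  assert (hj0 := pos_INR j).
  assert (b1 : bc (S (S m)) (S j) = (n + 1 - INR j) * bc (S (S m)) j / (INR j + 1)).
  { rewrite <- E2, <- bc_S_r. field. lra. }
  assert (b2 : bc (S m) j = (n + 1 - INR j) * bc (S (S m)) j / (n + 1)).
  { apply (Rmult_eq_reg_l (n + 1)); [|lra]. rewrite <- En at 1. rewrite <- bc_S_l, En. field. lra. }
  rewrite b1, b2, (S_INR j).
  set (x := INR j) in *. set (b := bc (S (S m)) j).
  replace (n + x + 1) with ((n + 1) + x) by ring.
  replace ((n + 1) + (x + 1)) with ((n + 1) + x + 1) by ring.
  rewrite (poch_S_l ((n + 1) + x) m).
  change (poch ((n + 1) + x + 1) (S (S m))) with (poch ((n + 1) + x + 1) m * ((n + 1) + x + 1 + INR m) * ((n + 1) + x + 1 + INR (S m))).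
  change (poch ((n + 1) + x + 1) (S m)) with (poch ((n + 1) + x + 1) m * ((n + 1) + x + 1 + INR m)).
  replace (t + 1 - (x + 1)) with (t - x) by ring.
  rewrite (poch_S_l (t - (x + 1))). replace (t - (x + 1) + 1) with (t - x) by ring.
  change (poch (t - x) (S (S m))) with (poch (t - x) (S m) * (t - x + INR (S m))).
  rewrite En, Em.
  set (p := poch (t - x) (S m)). set (w := poch ((n + 1) + x + 1) m).
  assert (T := term_rel_n n t x).
  apply (Rmult_eq_reg_r ((x + 1) ^ 2)); [|apply pow_nonzero; lra].
  match type of T with ?L = _ => transitivity (q * b ^ 2 * w * p * L) end.
  { field. lra. }
  rewrite T. field. lra.
- rewrite x1, x2. unfold Xt. simpl (INR 0). rewrite !bc_n_0.
  replace (S m - 1)%nat with m by lia.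
  rewrite !Rminus_0_r, Rplus_0_r.
  change (poch (n + 1) (S m)) with (poch (n + 1) m * ((n + 1) + INR m)).
  rewrite (poch_S_l t (S m)).
  change (poch (t + 1) (S (S m))) with (poch (t + 1) (S m) * (t + 1 + INR (S m))).
  rewrite Em, En. assert (T := term_rel_n_0 n t).
  apply Rminus_diag_uniq.
  match type of T with ?L = _ => transitivity (q * poch (t + 1) (S m) * poch (n + 1) m * L) end.
  + ring.
  + rewrite T. ring.
- rewrite bc_0 by lia. ring.
Qed.

(** * Recurrences for the series of the double sum *)

(** Order -1 allows G to grow linearly: two derivatives still bring it down to O(1/t). *)
Lemma Tf_series_rel (a b c : R) (n k : nat) (l1 l2 l3 : R) (n' : nat) (G : R -> R) :
  0 <= l1 -> 0 <= l2 -> 0 <= l3 -> symbol 2 (-1) G -> Derive_n G 2 1 = 0 ->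
  (forall t, 0 < t -> a * Tf n' l1 t + b * Tf n l2 t + c * Tf n l3 t = G (t + 1) - G t) ->
  a * dseries 2 1 (Tf n' l1) + b * dseries 2 1 (Tf n l2) + c * dseries 2 1 (Tf n l3) = 0.
Proof.
intros h1 h2 h3 hG h0 H.
rewrite (dseries_lin 2 1 2 (-1) (Tf n' l1) (Tf n l2) (Tf n l3) G a b c);
  try (apply symbol_Tf; assumption); try lia; try assumption.
change (INR 1) with 1. rewrite h0. ring.
Qed.

Lemma harm_S (n : nat) : harm (S n) = harm n + / (INR n + 1).
Proof. reflexivity. Qed.

Lemma Tf_series_rel_m (n : nat) (l : R) : (1 <= n)%nat -> 1 <= l ->
  cA (INR n) l * dseries 2 1 (Tf n (l - 1)) + cB (INR n) l * dseries 2 1 (Tf n l)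
    + cC (INR n) l * dseries 2 1 (Tf n (l + 1)) = 0.
Proof.
intros hn hl. assert (h1 : 1 <= INR n) by (apply (le_INR 1); exact hn).
apply (Rmult_eq_reg_l ((INR n + 1) ^ 3)); [|apply pow_nonzero; lra].
rewrite Rmult_0_r, !Rmult_plus_distr_l, <- !Rmult_assoc.
apply (Tf_series_rel _ _ _ n n (l - 1) l (l + 1) n
  (Xf n n l (xe0 (INR n) l) (xe1 (INR n) l) (xe2 (INR n) l) 0 0 0)); try lra.
- eapply symbol_cast; [apply symbol_Xf; exact hl|lia].
(* With k = n the harmonic numbers cancel up to 2/(n+1), leaving an identity between rational
   functions that ties [xe1] to [xe0]. *)
- apply Derive_2_Xf; [exact hl|exact hn|]. rewrite harm_S.
  unfold xe0, xe1. field. repeat split; lra.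
- intros t ht. apply Tf_rel_m; assumption.
Qed.

Lemma Tf_0 (l t : R) : Tf 0 l t = / (t * (t + l)).
Proof.
unfold Tf, Qf, Tt. simpl. rewrite bc_n_0, !Rplus_0_r, !Rmult_1_l.
unfold Rdiv. ring.
Qed.

Lemma Tf_1 (l t : R) : 
  Tf 1 l t = (t - 1) * ((l + 1) * t + (l + 2) * (t - 1)) / (t * (t + 1) * ((t + l) * (t + l + 1))).
Proof.
unfold Tf, Qf, Tt. simpl. unfold bc, Binomial.C; simpl.
unfold Rdiv. rewrite !Rmult_1_l, !Rplus_0_r, Rinv_1, Rminus_0_r. ring.
Qed.

Lemma Derive_2_explicit (f f' : R -> R) (v : R) :
  (forall t, 0 < t -> is_derive f t (f' t)) -> is_derive f' 1 v -> Derive_n f 2 1 = v.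
Proof.
intros h1 h2. change (Derive (Derive f) 1 = v).
rewrite (Derive_ext_loc _ f'); [apply is_derive_unique, h2|].
generalize (locally_pos 1 Rlt_0_1). apply filter_imp. intros t ht. apply is_derive_unique, h1, ht.
Qed.

Lemma symbol_inv_0 (k : nat) : symbol k 0 (fun t => / t).
Proof.
apply (symbol_ext k _ (fun t => / (t + 0))); [intros; rewrite Rplus_0_r; reflexivity|].
apply (symbol_cast k 1); [apply symbol_inv; lra|lia].
Qed.

Lemma symbol_scal (k : nat) (d : Z) (c : R) (f : R -> R) : symbol k d f -> symbol k d (fun t => c * f t).
Proof. intros h; apply (symbol_cast k (0 + d)); [apply (symbol_mult k 0 d (fun _ => c)); [apply symbol_const|exact h]|lia]. Qed.

Lemma Tf_series_rel_rho (n : nat) :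
  8 * (2 * INR n + 3) ^ 5 * dseries 2 1 (Tf (S n) (INR n + 2))
    + (INR n + 1) ^ 4 * (4 * INR n + 5) * (4 * INR n + 3) * dseries 2 1 (Tf n (INR n + 1)) = 0.
Proof.
assert (h0 := pos_INR n).
enough (H : 8 * (2 * INR n + 3) ^ 5 * dseries 2 1 (Tf (S n) (INR n + 2))
    + (INR n + 1) ^ 4 * (4 * INR n + 5) * (4 * INR n + 3) * dseries 2 1 (Tf n (INR n + 1))
    + 0 * dseries 2 1 (Tf n (INR n + 1)) = 0) by lra.
destruct n as [|n].
- simpl (INR 0).
  (* The general certificate assumes n >= 1; for n = 0 an explicit one serves. Its second derivative
     at 1 is -2622 + 5022 - 2400 = 0. *)
  apply (Tf_series_rel _ _ _ 0 0 (0 + 2) (0 + 1) (0 + 1) 1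
    (fun t => -1311 * / t + (20088 * / (t + 1) + -32400 * / (t + 2)))); try lra.
  + apply symbol_plus; [|apply symbol_plus]; apply symbol_scal; apply (symbol_le 2 2 0); try lia;
      try apply symbol_inv_0; apply (symbol_cast 2 1); try lia; apply symbol_inv; lra.
  + apply (Derive_2_explicit _ (fun t => 1311 * / t ^ 2 + (-20088 * / (t + 1) ^ 2 + 32400 * / (t + 2) ^ 2))).
    * intros t ht. auto_derive; [repeat split; lra|]. field. repeat split; lra.
    * auto_derive; [repeat split; lra|]. field.
  + intros t ht. rewrite Tf_0, Tf_1. field. repeat split; lra.
- assert (h1 := INR_1_le n).
  apply (Tf_series_rel _ _ _ (S n) 0 _ _ _ (S (S n))
    (Xf (S n) (S (S n)) (INR (S n) + 2) (ve0 (INR (S n))) (ve1 (INR (S n))) (ve2 (INR (S n)))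
       (vg0 (INR (S n))) (vg1 (INR (S n))) (vg2 (INR (S n))))); try lra.
  + eapply symbol_cast; [apply symbol_Xf; lra|lia].
  + apply Derive_2_Xf; [lra|lia|]. rewrite (harm_S (S n)).
    unfold ve0, ve1, vg0. field. repeat split; lra.
  + intros t ht. apply Tf_rel_rho; [lia|exact ht].
Qed.

Lemma Tf_series_rel_n (n : nat) :
  16 * (INR n + 1) ^ 6 * dseries 2 1 (Tf (S n) (INR n + 1))
    + 256 * (INR n + 1) ^ 3 * (2 * INR n + 1) ^ 4 * dseries 2 1 (Tf n (INR n))
    + - ((INR n + 1) ^ 3 * cR (INR n)) * dseries 2 1 (Tf n (INR n + 1)) = 0.
Proof.
assert (h0 := pos_INR n).
destruct n as [|n].
- simpl (INR 0).
  (* Again an explicit certificate for n = 0, with second derivative 1614 - 78 - 1536 = 0 at t =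
     1. *)
  apply (Tf_series_rel _ _ _ 0 0 (0 + 1) 0 (0 + 1) 1
    (fun t => 807 * / t + (-312 * / (t + 1) + -256 * (/ t * / t)))); try lra.
  + apply symbol_plus; [|apply symbol_plus]; apply symbol_scal.
    * apply (symbol_cast 2 0); [apply symbol_inv_0|lia].
    * apply (symbol_cast 2 1); [apply symbol_inv; lra|lia].
    * apply (symbol_cast 2 (0 + 0)); [apply symbol_mult; apply symbol_inv_0|lia].
  + apply (Derive_2_explicit _ (fun t => -807 * / t ^ 2 + (312 * / (t + 1) ^ 2 + 512 * / t ^ 3))).
    * intros t ht. auto_derive; [repeat split; lra|]. field. repeat split; lra.
    * auto_derive; [repeat split; lra|]. field.
  + intros t ht. rewrite !Tf_0, Tf_1. unfold cR. field. repeat split; lra.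
- assert (h1 := INR_1_le n).
  apply (Tf_series_rel _ _ _ (S n) 0 _ _ _ (S (S n))
    (Xf (S n) (S (S n)) (INR (S n) + 1) (ue0 (INR (S n))) (ue1 (INR (S n))) (ue2 (INR (S n)))
       (ue0 (INR (S n))) (ug1 (INR (S n))) (ug2 (INR (S n))))); try lra.
  + eapply symbol_cast; [apply symbol_Xf; lra|lia].
  + apply Derive_2_Xf; [lra|lia|]. rewrite (harm_S (S n)).
    unfold ue0, ue1. field. repeat split; lra.
  + intros t ht. apply Tf_rel_n; [lia|exact ht].
Qed.

(** * Relations for the well-poised sum *)

Definition kap (n m l : nat) : R :=
  (-1) ^ m * INR (fact n) ^ 2 / (INR (fact m) * INR (fact (n + l))).

(** First function of the theorem for l = n - m, once [poch (t + n + 1) l] is cancelled: the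
    denominator becomes a fourth power that does not depend on m. *)
Definition Rf (n m l : nat) (t : R) : R :=
  kap n m l * (t + INR n / 2)
  * (poch (t - INR n) m * poch (t + INR n + INR l + 1) m
     * poch (t - INR n - INR l) (n + l) * poch (t + INR n + 1) (n + l))
  * / poch t (S n) ^ 4.

(* Gosper certificate of the three-term recurrence in m of the well-poised function. *)
Definition Kf (n m l : nat) (t : R) : R :=
  poch (t - INR n - 1) m * poch (t - INR n - INR l) (n + l)
  * (poch (t + INR n + INR l + 1) m * poch (t + INR n) (n + l) * / poch t n ^ 4).

Lemma symbol_inv_poch_4 (k n : nat) : symbol k (4 * Z.of_nat n) (fun t => / poch t n ^ 4).
Proof.
assert (h := symbol_inv_poch k n 0 (Rle_refl 0)).
apply (symbol_ext k _ (fun t => (/ poch (t + 0) n * / poch (t + 0) n) * (/ poch (t + 0) n * / poch (t + 0) n))).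
- intros t ht. rewrite Rplus_0_r. assert (p := poch_pos t n ht). field. lra.
- eapply symbol_cast; [apply symbol_mult; apply symbol_mult; exact h|lia].
Qed.

Lemma symbol_Rf (k n m l : nat) : n = (m + l)%nat -> symbol k 3 (Rf n m l).
Proof.
intros hn. unfold Rf. generalize (kap n m l); intros c.
apply (symbol_ext k _ (fun t => c * (t + INR n / 2)
  * (poch (t + - INR n) m * poch (t + (INR n + INR l + 1)) m
     * poch (t + (- INR n - INR l)) (n + l) * poch (t + (INR n + 1)) (n + l))
  * / poch t (S n) ^ 4)).
- intros t _. unfold Rminus. rewrite !Rplus_assoc. reflexivity.
- eapply symbol_cast.
  + repeat (apply symbol_mult); try apply symbol_poch; try apply symbol_inv_poch_4; try apply symbol_shift.
    apply symbol_const.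
  + lia.
Qed.

Lemma symbol_Kf (k n m l : nat) : n = (m + l)%nat -> symbol k 0 (Kf n m l).
Proof.
intros hn. unfold Kf.
apply (symbol_ext k _ (fun t => poch (t + (- INR n - 1)) m * poch (t + (- INR n - INR l)) (n + l)
  * (poch (t + (INR n + INR l + 1)) m * poch (t + INR n) (n + l) * / poch t n ^ 4))).
- intros t _. unfold Rminus. rewrite !Rplus_assoc. reflexivity.
- eapply symbol_cast.
  + repeat (apply symbol_mult); try apply symbol_poch; try apply symbol_inv_poch_4.
  + lia.
Qed.

Lemma Rf_rel_m (n m l : nat) (t : R) : n = (m + l + 2)%nat -> 0 < t ->
  cA (INR n) (INR l + 1) * Rf n (S (S m)) l t + cB (INR n) (INR l + 1) * Rf n (S m) (S l) t
    + cC (INR n) (INR l + 1) * Rf n m (S (S l)) t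
  = kap n (S m) (S l) * INR n * (2 * INR n + 2 * INR l + 3) * Kf n (S m) (S l) (t + 1)
    - kap n (S m) (S l) * INR n * (2 * INR n + 2 * INR l + 3) * Kf n (S m) (S l) t.
Proof.
intros hn ht. assert (hm : INR m = INR n - INR l - 2) by (rewrite hn, !plus_INR; simpl; ring).
assert (hm0 := pos_INR m). assert (hl0 := pos_INR l).
unfold Rf, Kf, kap.
replace (n + S (S l))%nat with (S (S (n + l))) by lia.
replace (n + S l)%nat with (S (n + l)) by lia.
rewrite (poch_S_l t n).
change (poch (t + 1) n) with (poch (t + 1) n).
assert (p1 := poch_pos (t + 1) n ltac:(lra)).
assert (E : poch t n = t * poch (t + 1) n / (t + INR n)).
{ rewrite <- poch_S_l. simpl. field. lra. }
rewrite E. rewrite !S_INR, !fact_S, !S_INR, plus_INR.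
set (N := INR n) in *. set (L := INR l) in *.
replace (t + N + (L + 1 + 1) + 1) with (t + N + L + 1 + 1 + 1) by ring.
replace (t + N + (L + 1) + 1) with (t + N + L + 1 + 1) by ring.
replace (t + 1 + N + (L + 1) + 1) with (t + N + L + 1 + 1 + 1) by ring.
rewrite (poch_S_l (t + N + L + 1) (S m)), !(poch_S_l (t + N + L + 1 + 1) m).
replace (t + 1 - N - 1) with (t - N) by ring.
rewrite (poch_S_l (t - N - 1) m). replace (t - N - 1 + 1) with (t - N) by ring.
replace (t - N - (L + 1 + 1)) with (t - N - L - 1 - 1) by ring.
replace (t - N - (L + 1)) with (t - N - L - 1) by ring.
replace (t + 1 - N - (L + 1)) with (t - N - L) by ring.
rewrite (poch_S_l (t - N - L - 1 - 1) (S (n + l))). 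
replace (t - N - L - 1 - 1 + 1) with (t - N - L - 1) by ring.
rewrite !(poch_S_l (t - N - L - 1) (n + l)).
replace (t - N - L - 1 + 1) with (t - N - L) by ring.
rewrite (poch_S_l (t + N) (n + l)).
replace (t + 1 + N) with (t + N + 1) by ring.
cbn [poch pow]. rewrite !S_INR, plus_INR. fold N L. rewrite hm.
set (a := poch (t - N) m). set (u := poch (t + N + L + 1 + 1 + 1) m).
set (w := poch (t - N - L) (n + l)). set (v := poch (t + N + 1) (n + l)).
set (D := poch (t + 1) n) in *. set (f1 := INR (fact n)).
assert (f2 := INR_fact_lt_0 m). assert (f3 := INR_fact_lt_0 (n + l)).
set (fm := INR (fact m)) in *. set (fl := INR (fact (n + l))) in *.
unfold cA, cB, cC. assert (0 <= N - L - 2) by (rewrite <- hm; exact hm0).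
field. repeat split; lra.
Qed.

Lemma Rf_rel_m0 (n l : nat) (t : R) : n = S l -> 0 < t ->
  cA (INR n) (INR l + 1) * Rf n 1 l t + cB (INR n) (INR l + 1) * Rf n 0 (S l) t
    + 0 * Rf n 0 (S l) t
  = kap n 0 (S l) * INR n * (2 * INR n + 2 * INR l + 3) * Kf n 0 (S l) (t + 1)
    - kap n 0 (S l) * INR n * (2 * INR n + 2 * INR l + 3) * Kf n 0 (S l) t.
Proof.
intros hn ht. assert (hl0 := pos_INR l).
assert (hN : INR n = INR l + 1) by (rewrite hn, S_INR; reflexivity).
unfold Rf, Kf, kap. replace (n + S l)%nat with (S (n + l)) by lia.
rewrite (poch_S_l t n).
assert (p1 := poch_pos (t + 1) n ltac:(lra)).
assert (E : poch t n = t * poch (t + 1) n / (t + INR n)).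
{ rewrite <- poch_S_l. simpl. field. lra. }
rewrite E, !fact_S, S_INR, plus_INR.
set (N := INR n) in *. set (L := INR l) in *.
replace (t - N - (L + 1)) with (t - N - L - 1) by ring.
replace (t + 1 - N - (L + 1)) with (t - N - L) by ring.
rewrite !(poch_S_l (t - N - L - 1) (n + l)).
replace (t - N - L - 1 + 1) with (t - N - L) by ring.
rewrite (poch_S_l (t + N) (n + l)).
replace (t + 1 + N) with (t + N + 1) by ring.
cbn [poch pow INR fact]. rewrite plus_INR. fold N L.
set (w := poch (t - N - L) (n + l)). set (v := poch (t + N + 1) (n + l)).
set (D := poch (t + 1) n) in *. set (f1 := INR (fact n)).
assert (f3 := INR_fact_lt_0 (n + l)).
set (fl := INR (fact (n + l))) in *. rewrite hN.
unfold cA, cB. change (INR (1 + 0 * 1)) with 1. change (INR 1) with 1. 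
field. repeat split; lra.
Qed.

(** * Boundary terms and series of the well-poised sum *)

Lemma Derive_two_zeros (f g h : R -> R) (x : R) :
  ex_derive f x -> ex_derive g x -> ex_derive h x -> f x = 0 -> g x = 0 ->
  Derive (fun t => f t * g t * h t) x = 0.
Proof.
intros hf hg hh hf0 hg0.
rewrite (Derive_mult (fun t => f t * g t) h); [|apply ex_derive_mult; assumption|assumption].
rewrite (Derive_mult f g) by assumption.
rewrite hf0, hg0. ring.
Qed.

Lemma Derive_one_zero (f h : R -> R) (x : R) :
  ex_derive f x -> ex_derive h x -> f x = 0 -> Derive (fun t => f t * h t) x = Derive f x * h x.
Proof. intros hf hh hf0. rewrite (Derive_mult f h) by assumption. rewrite hf0. ring. Qed.

Lemma ex_derive_poch_minus (a b : R) (k : nat) (x : R) : ex_derive (fun t => poch (t - a - b) k) x.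
Proof.
exists (dpoch (x + (- a - b)) k).
apply (is_derive_ext (fun t => poch (t + (- a - b)) k)); [|apply is_derive_poch].
intros t. f_equal. ring.
Qed.

Lemma Derive_poch_minus (a b u : R) (k : nat) (x : R) : x - a - b = u ->
  Derive (fun t => poch (t - a - b) k) x = dpoch u k.
Proof.
intros <-. apply is_derive_unique. replace (x - a - b) with (x + (- a - b)) by ring.
apply (is_derive_ext (fun t => poch (t + (- a - b)) k)); [|apply is_derive_poch].
intros t. f_equal. ring.
Qed.

Lemma symbol_ex_derive (d : Z) (f : R -> R) (x : R) : symbol 1 d f -> 0 < x -> ex_derive f x.
Proof. intros [_ [h _]] hx. apply h, hx. Qed.

Lemma ex_derive_tail (n m l : nat) (x : R) : 0 < x ->
  ex_derive (fun t => poch (t + INR n + INR l + 1) m * poch (t + INR n) (n + l) * / poch t n ^ 4) x.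
Proof.
intros hx.
refine (symbol_ex_derive _ _ x (symbol_ext 1 _ (fun t => poch (t + (INR n + INR l + 1)) m * poch (t + INR n) (n + l) * / poch t n ^ 4) _ _ _) hx).
- intros t _. rewrite !Rplus_assoc. reflexivity.
- apply symbol_mult; [apply symbol_mult; apply symbol_poch|apply symbol_inv_poch_4].
Qed.

(** The starting point n + 1 does not depend on m, so the three series of a recurrence in m share
    one boundary. *)
Definition Rf_series (n m l : nat) : R := dseries 1 (n + 1) (Rf n m l).

(** At t = n + 1 the certificate has a double zero, one from [poch (t - n - 1) (m + 1)] and one from
    [poch (t - n - l - 1) (n + l + 1)], so the boundary term is 0. *)
Lemma Rf_series_rel_m (n m l : nat) : n = (m + l + 2)%nat ->
  cA (INR n) (INR l + 1) * Rf_series n (S (S m)) l + cB (INR n) (INR l + 1) * Rf_series n (S m) (S l)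
    + cC (INR n) (INR l + 1) * Rf_series n m (S (S l)) = 0.
Proof.
intros hn. unfold Rf_series.
rewrite (dseries_lin 1 (n + 1) 3 0 _ _ _
  (fun t => kap n (S m) (S l) * INR n * (2 * INR n + 2 * INR l + 3) * Kf n (S m) (S l) t)
  _ _ _); try lia; try (apply symbol_Rf; lia).
- change (Derive_n ?f 1 ?x) with (Derive f x). rewrite Derive_scal.
  replace (Derive (Kf n (S m) (S l)) (INR (n + 1))) with 0; [ring|].
  assert (hp : 0 < INR (n + 1)) by (apply lt_0_INR; lia).
  symmetry. apply (Derive_two_zeros (fun t => poch (t - INR n - 1) (S m))
    (fun t => poch (t - INR n - INR (S l)) (n + S l))
    (fun t => poch (t + INR n + INR (S l) + 1) (S m) * poch (t + INR n) (n + S l) * / poch t n ^ 4)).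
  + apply ex_derive_poch_minus.
  + apply ex_derive_poch_minus.
  + apply ex_derive_tail, hp.
  + rewrite plus_INR. replace (INR n + INR 1 - INR n - 1) with (- INR 0) by (simpl; ring).
    apply poch_neg_0. lia.
  + rewrite plus_INR, (S_INR l). replace (INR n + INR 1 - INR n - (INR l + 1)) with (- INR l) by (simpl; ring).
    apply poch_neg_0. lia.
- apply symbol_scal, symbol_Kf. lia.
- intros t ht. apply Rf_rel_m; assumption.
Qed.

(* One sixth of the sum of the second derivatives of [Tf n (n + 1)] divided by n!; on the
   well-poised side the same number is a boundary term, since the factor 1/m! removes the term
   m = -1. *)
Definition rho (n : nat) : R :=
  (-1) ^ n * INR (fact n) ^ 8 * INR (fact (4 * n + 1))
  / (3 * INR (fact (2 * n)) ^ 6 * (2 * INR n + 1) ^ 5).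

Lemma poch_INR (a b : nat) (x : R) : x = INR a + 1 -> poch x b = INR (fact (a + b)) / INR (fact a).
Proof. intros ->. apply poch_fact. Qed.

(** Here [poch (t - n - 1) 0] = 1 no longer vanishes; the simple zero that remains is differentiated
    by [dpoch_neg], and the factorials combine into [rho]. *)
Lemma Rf_series_rel_m0 (n l : nat) : n = S l ->
  cA (INR n) (INR l + 1) * Rf_series n 1 l + cB (INR n) (INR l + 1) * Rf_series n 0 (S l)
  = 3 * cC (INR n) (INR l + 1) * rho n.
Proof.
intros En. unfold Rf_series.
transitivity (cA (INR n) (INR l + 1) * dseries 1 (n + 1) (Rf n 1 l)
  + cB (INR n) (INR l + 1) * dseries 1 (n + 1) (Rf n 0 (S l)) + 0 * dseries 1 (n + 1) (Rf n 0 (S l))); [ring|].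
rewrite (dseries_lin 1 (n + 1) 3 0 _ _ _
  (fun t => kap n 0 (S l) * INR n * (2 * INR n + 2 * INR l + 3) * Kf n 0 (S l) t)
  _ _ _); try lia; try (apply symbol_Rf; lia).
- change (Derive_n ?f 1 ?x) with (Derive f x). rewrite Derive_scal.
  assert (hp : 0 < INR (n + 1)) by (apply lt_0_INR; lia).
  assert (ED : Derive (Kf n 0 (S l)) (INR (n + 1)) =
    (-1) ^ l * INR (fact l) * INR (fact n) * (INR (fact (4 * n)) / INR (fact (2 * n)))
     * / (INR (fact (2 * n)) / INR (fact n)) ^ 4).
  { rewrite (Derive_ext (Kf n 0 (S l)) (fun t => poch (t - INR n - INR (S l)) (n + S l) * 
      (poch (t + INR n + INR (S l) + 1) 0 * poch (t + INR n) (n + S l) * / poch t n ^ 4))).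
    - rewrite Derive_one_zero.
      + rewrite (Derive_poch_minus _ _ (- INR l)) by (rewrite plus_INR, (S_INR l); simpl; ring).
        replace (n + S l)%nat with (l + S n)%nat by lia. rewrite dpoch_neg.
        rewrite (poch_INR (2 * n) (l + S n) (INR (n + 1) + INR n))
          by (rewrite plus_INR, mult_INR; simpl; ring).
        rewrite (poch_INR n n (INR (n + 1))) by (rewrite plus_INR; reflexivity).
        replace (2 * n + (l + S n))%nat with (4 * n)%nat by lia.
        replace (n + n)%nat with (2 * n)%nat by lia. cbn [poch]. ring.
      + apply ex_derive_poch_minus.
      + apply ex_derive_tail, hp.
      + rewrite plus_INR, (S_INR l). replace (INR n + INR 1 - INR n - (INR l + 1)) with (- INR l) by (simpl; ring).
        apply poch_neg_0. lia.
    - intros t. unfold Kf. cbn [poch]. ring. }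
  rewrite ED. unfold kap, rho, cC.
  replace (n + S l)%nat with (2 * n)%nat by lia.
  replace (4 * n + 1)%nat with (S (4 * n)) by lia. rewrite fact_S.
  assert (f1 := INR_fact_lt_0 (2 * n)). assert (f2 := INR_fact_lt_0 l). assert (f4 := INR_fact_lt_0 (4 * n)).
  assert (hn : INR n = INR l + 1) by (rewrite En, S_INR; reflexivity).
  assert (hfn : INR (fact n) = (INR l + 1) * INR (fact l)) by (rewrite En; apply fact_S).
  rewrite mult_INR, hfn, hn. replace ((-1) ^ n) with ((-1) ^ S l) by (rewrite En; reflexivity).
  change ((-1) ^ S l) with (-1 * (-1) ^ l). cbn [pow fact].
  assert (hl := pos_INR l). simpl (INR 1). simpl (INR 4).
  field. repeat split; lra.
- apply symbol_scal, symbol_Kf. lia.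
- intros t ht. apply Rf_rel_m0; assumption.
Qed.

(* Gosper certificate for the first-order recurrence in n of the well-poised function at m = 0. *)
Definition gx (n t : R) : R :=
  2264*n^5+4960*n^4+4416*n^3+2032*n^2+488*n+48 + (4580*n^4+8180*n^3+5356*n^2+1548*n+176)*t
  + (820*n^2+1000*n+308)*((4*n+1)*t^2 + t^3).

Definition Gr (n : nat) (t : R) : R :=
  poch (t - INR n - (INR n + 1)) (n + S n) *
  (kap n 0 n / (2 * INR n + 1) * gx (INR n) t * poch (t + (INR n + 1)) (n + n) * / poch t (S n) ^ 4).

Lemma Rf_rel_n (n : nat) (t : R) : 0 < t ->
  16 * (INR n + 1) ^ 4 * Rf (S n) 0 (S n) t + 256 * (2 * INR n + 1) ^ 4 * Rf n 0 n t
    + 0 * Rf n 0 n t = Gr n (t + 1) - Gr n t.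
Proof.
intros ht. assert (hn0 := pos_INR n).
unfold Rf, Gr, kap.
replace (S n + S n)%nat with (S (S (n + n))) by lia.
replace (n + S n)%nat with (S (n + n)) by lia.
rewrite !fact_S, !S_INR, plus_INR.
assert (D0 := poch_pos t (S n) ht).
change (poch t (S (S n))) with (poch t (S n) * (t + INR (S n))).
rewrite (poch_shift t) by lra. rewrite !S_INR.
set (N := INR n) in *.
replace (t + (N + 1) + 1) with (t + N + 1 + 1) by ring.
replace (t + 1 + (N + 1)) with (t + N + 1 + 1) by ring.
replace (t + (N + 1)) with (t + N + 1) by ring.
assert (v0 : poch (t + N + 1) (n + n) = (t + N + 1) * poch (t + N + 1 + 1) (n + n) / (t + 3 * N + 1)).
{ rewrite (poch_shift (t + N + 1)) by lra. rewrite plus_INR. fold N. field. split; lra. }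
rewrite v0.
replace (t - (N + 1) - (N + 1)) with (t - N - N - 1 - 1) by ring.
replace (t - N - (N + 1)) with (t - N - N - 1) by ring.
replace (t + 1 - N - (N + 1)) with (t - N - N) by ring.
rewrite (poch_S_l (t - N - N - 1 - 1)). replace (t - N - N - 1 - 1 + 1) with (t - N - N - 1) by ring.
rewrite !(poch_S_l (t - N - N - 1)). replace (t - N - N - 1 + 1) with (t - N - N) by ring.
change (poch (t - N - N) (S (n + n))) with (poch (t - N - N) (n + n) * (t - N - N + INR (n + n))).
change (poch (t + N + 1 + 1) (S (S (n + n)))) with
  (poch (t + N + 1 + 1) (n + n) * (t + N + 1 + 1 + INR (n + n)) * (t + N + 1 + 1 + INR (S (n + n)))).
rewrite S_INR, !plus_INR. fold N.
cbn [pow fact]. repeat match goal with |- context [poch ?x 0] => change (poch x 0) with 1 end.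
set (w := poch (t - N - N) (n + n)). set (v := poch (t + N + 1 + 1) (n + n)).
set (D := poch t (S n)) in *. set (f1 := INR (fact n)).
assert (f2 := INR_fact_lt_0 (n + n)). set (f3 := INR (fact (n + n))) in *.
change (INR 1) with 1. unfold gx.
field. repeat split; lra.
Qed.

Lemma dseries_S (k s : nat) (d : Z) (f : R -> R) :
  symbol k d f -> (2 <= d + Z.of_nat k)%Z -> (1 <= s)%nat ->
  dseries k s f = Derive_n f k (INR s) + dseries k (S s) f.
Proof.
intros hf hd hs. unfold dseries. rewrite Series_incr_1 by (apply (symbol_ex_series k d); assumption).
f_equal. apply Series_ext. intros i. do 2 f_equal. lia.
Qed.

Lemma ex_derive_head (n m l : nat) (x : R) : 0 < x ->
  ex_derive (fun t => kap n m l * (t + INR n / 2) * poch (t + (INR n + 1)) (n + l) * / poch t (S n) ^ 4) x.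
Proof.
intros hx.
refine (symbol_ex_derive _ _ x _ hx).
generalize (kap n m l); intros c.
repeat apply symbol_mult; try apply symbol_poch; try apply symbol_inv_poch_4; try apply symbol_shift. apply symbol_const.
Qed.

Lemma Rf_series_rel_n (n : nat) :
  16 * (INR n + 1) ^ 4 * Rf_series (S n) 0 (S n) + 256 * (2 * INR n + 1) ^ 4 * Rf_series n 0 n
  = - 3 * cR (INR n) * rho n.
Proof.
assert (hn0 := pos_INR n).
assert (hp : 0 < INR (n + 1)) by (apply lt_0_INR; lia).
assert (H : 16 * (INR n + 1) ^ 4 * dseries 1 (n + 1) (Rf (S n) 0 (S n))
  + 256 * (2 * INR n + 1) ^ 4 * dseries 1 (n + 1) (Rf n 0 n) + 0 * dseries 1 (n + 1) (Rf n 0 n)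
  = - Derive (Gr n) (INR (n + 1))).
{ apply (dseries_lin 1 (n + 1) 3 0); try lia; try (apply symbol_Rf; lia).
  - apply (symbol_ext 1 _ (fun t => poch (t + (- INR n - (INR n + 1))) (n + S n) *
      (kap n 0 n / (2 * INR n + 1) * gx (INR n) t * poch (t + (INR n + 1)) (n + n) * / poch t (S n) ^ 4))).
    + intros t _. unfold Gr. do 2 f_equal. ring.
    + eapply symbol_cast.
      * apply symbol_mult; [apply symbol_poch|]. apply symbol_mult; [|apply symbol_inv_poch_4].
        apply symbol_mult; [|apply symbol_poch]. apply (symbol_mult 1 0 (-3) (fun _ => _)); [apply symbol_const|].
        unfold gx. apply symbol_plus; [apply symbol_plus|].
        -- apply (symbol_cast 1 0); [apply symbol_const|lia].
        -- apply (symbol_cast 1 (0 + -1)); [apply (symbol_mult 1 0 (-1) (fun _ => _)); [apply symbol_const|apply symbol_id]|lia].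
        -- apply (symbol_cast 1 (0 + -3)); [apply (symbol_mult 1 0 (-3) (fun _ => _)); [apply symbol_const|]|lia].
           apply symbol_plus.
           ++ apply (symbol_cast 1 (0 + (-1 + (-1 + 0)))); [|lia]. apply (symbol_mult 1 0 _ (fun _ => _)); [apply symbol_const|].
              simpl. apply (symbol_mult 1 (-1) (-1)); [apply symbol_id|]. apply (symbol_mult 1 (-1) 0); [apply symbol_id|apply symbol_const].
           ++ simpl. apply (symbol_mult 1 (-1) (-2)); [apply symbol_id|]. apply (symbol_mult 1 (-1) (-1)); [apply symbol_id|]. apply (symbol_mult 1 (-1) 0); [apply symbol_id|apply symbol_const].
      * lia.
  - intros t ht. apply Rf_rel_n, ht. }
(* The telescoped sum starts at n + 1 but [Rf_series (S n)] starts at n + 2: the term at n + 1 is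
   split off and joins the boundary term. Both are derivatives at a simple zero, computed in [E2]
   and [E1]. *)
rewrite (dseries_S 1 (n + 1) 3 (Rf (S n) 0 (S n))) in H by (try (apply symbol_Rf); lia).
change (Derive_n ?f 1 ?x) with (Derive f x) in H.
assert (E1 : Derive (Gr n) (INR (n + 1)) = (-1) ^ n * INR (fact n) * INR (fact n) *
   (kap n 0 n / (2 * INR n + 1) * gx (INR n) (INR n + 1) * (INR (fact (4 * n + 1)) / INR (fact (2 * n + 1)))
     * / (INR (fact (2 * n + 1)) / INR (fact n)) ^ 4)).
{ unfold Gr. rewrite (Derive_one_zero (fun t => poch (t - INR n - (INR n + 1)) (n + S n))).
  - rewrite (Derive_poch_minus _ _ (- INR n)) by (rewrite plus_INR; simpl; ring).
    rewrite dpoch_neg.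
    rewrite (poch_INR (2 * n + 1) (n + n)) by (rewrite !plus_INR, mult_INR; simpl; ring).
    rewrite (poch_INR n (S n) (INR (n + 1))) by (rewrite plus_INR; reflexivity).
    replace (2 * n + 1 + (n + n))%nat with (4 * n + 1)%nat by lia.
    replace (n + S n)%nat with (2 * n + 1)%nat by lia.
    rewrite plus_INR. reflexivity.
  - apply ex_derive_poch_minus.
  - assert (ex_derive (gx (INR n)) (INR (n + 1))) by (unfold gx; auto_derive; exact I).
    apply ex_derive_mult; [apply ex_derive_mult; [apply ex_derive_mult; [apply ex_derive_const|assumption]|]|].
    + exact (symbol_ex_derive _ _ _ (symbol_poch 1 _ _) hp).
    + exact (symbol_ex_derive _ _ _ (symbol_inv_poch_4 1 _) hp).
  - rewrite plus_INR. replace (INR n + INR 1 - INR n - (INR n + 1)) with (- INR n) by (simpl; ring).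
    apply poch_neg_0. lia. }
assert (E2 : Derive (Rf (S n) 0 (S n)) (INR (n + 1)) = (-1) ^ (S n) * INR (fact (S n)) * INR (fact n) *
   (kap (S n) 0 (S n) * ((INR n + 1) * (3 / 2)) * (INR (fact (4 * n + 4)) / INR (fact (2 * n + 2)))
     * / (INR (fact (2 * n + 2)) / INR (fact n)) ^ 4)).
{ rewrite (Derive_ext (Rf (S n) 0 (S n)) (fun t => poch (t - INR (S n) - INR (S n)) (S n + S n) *
   (kap (S n) 0 (S n) * (t + INR (S n) / 2) * poch (t + (INR (S n) + 1)) (S n + S n) * / poch t (S (S n)) ^ 4))).
  2:{ intros t. unfold Rf. cbn [poch]. rewrite <- !Rplus_assoc. ring. }
  rewrite Derive_one_zero.
  - rewrite (Derive_poch_minus _ _ (- INR (S n))) by (rewrite plus_INR, (S_INR n); simpl; ring).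
    rewrite dpoch_neg.
    rewrite (poch_INR (2 * n + 2) (S n + S n)) by (rewrite !plus_INR, mult_INR, (S_INR n); simpl; ring).
    rewrite (poch_INR n (S (S n)) (INR (n + 1))) by (rewrite plus_INR; reflexivity).
    replace (2 * n + 2 + (S n + S n))%nat with (4 * n + 4)%nat by lia.
    replace (n + S (S n))%nat with (2 * n + 2)%nat by lia.
    replace (INR (n + 1) + INR (S n) / 2) with ((INR n + 1) * (3 / 2))
      by (rewrite (plus_INR n), (S_INR n); simpl; field). reflexivity.
  - apply ex_derive_poch_minus.
  - exact (ex_derive_head (S n) 0 (S n) _ hp).
  - rewrite plus_INR, (S_INR n). replace (INR n + INR 1 - (INR n + 1) - (INR n + 1)) with (- INR (S n)) by (rewrite (S_INR n); simpl; ring).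
    apply poch_neg_0. lia. }
unfold Rf_series. replace (S n + 1)%nat with (S (n + 1)) by lia.
enough (H2 : 16 * (INR n + 1) ^ 4 * Derive (Rf (S n) 0 (S n)) (INR (n + 1)) + Derive (Gr n) (INR (n + 1))
   = 3 * cR (INR n) * rho n) by lra.
rewrite E1, E2. unfold kap, rho, cR, gx.
replace (S n + S n)%nat with (S (S (2 * n))) by lia. replace (n + n)%nat with (2 * n)%nat by lia.
replace (2 * n + 2)%nat with (S (S (2 * n))) by lia. replace (2 * n + 1)%nat with (S (2 * n)) by lia.
replace (4 * n + 4)%nat with (S (S (S (S (4 * n))))) by lia. replace (4 * n + 1)%nat with (S (4 * n)) by lia.
rewrite !fact_S, !S_INR, !mult_INR.
assert (f1 := INR_fact_lt_0 n). assert (f2 := INR_fact_lt_0 (2 * n)). assert (f4 := INR_fact_lt_0 (4 * n)).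
change (INR 2) with 2. replace (INR 4) with 4 by (simpl; ring).
set (F1 := INR (fact n)) in *. set (F2 := INR (fact (2 * n))) in *. set (F4 := INR (fact (4 * n))) in *.
set (N := INR n) in *. cbn [pow fact]. change (INR 1) with 1.
field. repeat split; lra.
Qed.

(** * Comparison of the two sides *)

(** The ratio prescribed by [Tf_series_rel_rho], less one factor n + 1 that is absorbed by n!. *)
Lemma rho_S (n : nat) :
  8 * (2 * INR n + 3) ^ 5 * rho (S n)
  = - ((INR n + 1) ^ 3 * (4 * INR n + 5) * (4 * INR n + 3) * rho n).
Proof.
assert (hn0 := pos_INR n). unfold rho.
replace (4 * S n + 1)%nat with (S (S (S (S (4 * n + 1))))) by lia.
replace (2 * S n)%nat with (S (S (2 * n))) by lia.
rewrite !fact_S, !S_INR, plus_INR, !mult_INR.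
assert (f1 := INR_fact_lt_0 n). assert (f2 := INR_fact_lt_0 (2 * n)).
change (INR 2) with 2. replace (INR 4) with 4 by (simpl; ring). change (INR 1) with 1.
set (F1 := INR (fact n)) in *. set (F2 := INR (fact (2 * n))) in *.
set (F4 := INR (fact (4 * n + 1))). set (N := INR n) in *. cbn [pow].
field. repeat split; lra.
Qed.

Lemma Tf_series_rho (n : nat) : dseries 2 1 (Tf n (INR n + 1)) = 6 * INR (fact n) * rho n.
Proof.
induction n as [|n IH].
- unfold dseries.
  assert (S1 : symbol 2 0 (fun t => - / t)).
  { apply (symbol_ext 2 _ (fun t => -1 * / t)); [intros; ring|]. apply symbol_scal, symbol_inv_0. }
  (* For n = 0 the summand is 1/(t(t+1)), the difference of -1/t, and the sum is 2 = 6 [rho 0]. *)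
  rewrite (is_series_unique _ _ (dseries_tele 2 1 0 (Tf 0 (INR 0 + 1)) (fun t => - / t) S1 ltac:(lia) ltac:(lia)
    ltac:(intros t ht; rewrite Tf_0; simpl; field; split; lra))).
  change (INR 1) with 1. rewrite (Derive_2_explicit _ (fun t => / t ^ 2) (-2)).
  + unfold rho. simpl. field.
  + intros t ht. auto_derive; [lra|]. field. lra.
  + auto_derive; [lra|]. field.
- assert (h := Tf_series_rel_rho n). rewrite IH in h. assert (hr := rho_S n). assert (hn0 := pos_INR n).
  rewrite S_INR. replace (INR n + 1 + 1) with (INR n + 2) by ring.
  apply (Rmult_eq_reg_l (8 * (2 * INR n + 3) ^ 5)).
  + rewrite fact_S.
    transitivity (6 * ((INR n + 1) * INR (fact n)) * (8 * (2 * INR n + 3) ^ 5 * rho (S n))); [|ring].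
    rewrite hr. lra.
  + apply Rmult_integral_contrapositive_currified; [lra|apply pow_nonzero; lra].
Qed.

(** The functions are 1/t^2 and 1/t^3, so the series agree term by term: 6/t^4 = -2 (-3/t^4). *)
Lemma series_eq_0_0 : dseries 2 1 (Tf 0 (INR 0)) = - 2 * Rf_series 0 0 0.
Proof.
unfold Rf_series, dseries. rewrite <- Series_scal_l. apply Series_ext. intros i.
assert (hp : 0 < INR (i + 1)) by (apply lt_0_INR; lia).
change (0 + 1)%nat with 1%nat. set (x := INR (i + 1)) in *.
change (Derive_n (Rf 0 0 0) 1 x) with (Derive (Rf 0 0 0) x).
change (Derive_n (Tf 0 (INR 0)) 2 x) with (Derive (Derive (Tf 0 (INR 0))) x).
rewrite (Derive_ext_loc (Derive (Tf 0 (INR 0))) (fun t : R => -2 * / t ^ 3)).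
- rewrite (Derive_ext_loc (Rf 0 0 0) (fun t : R => / t ^ 3)).
  + replace (Derive (fun t : R => / t ^ 3) x) with (-3 * / x ^ 4).
    * apply is_derive_unique. auto_derive; [solve [lra | repeat apply Rmult_integral_contrapositive_currified; lra]|]. simpl; field; lra.
    * symmetry. apply is_derive_unique. auto_derive; [solve [lra | repeat apply Rmult_integral_contrapositive_currified; lra]|]. simpl; field; lra.
  + apply eq_pos_locally; [|exact hp]. intros t ht. unfold Rf, kap. simpl. field. lra.
- apply eq_pos_locally; [|exact hp]. intros t ht.
  rewrite (Derive_ext_pos _ (fun t => / (t * t))) by (try exact ht; intros; rewrite Tf_0, Rplus_0_r; reflexivity).
  apply is_derive_unique. auto_derive; [solve [lra | repeat apply Rmult_integral_contrapositive_currified; lra]|]. field. lra.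
Qed.

Lemma series_eq_m0 (n : nat) : dseries 2 1 (Tf n (INR n)) = - 2 * INR (fact n) * Rf_series n 0 n.
Proof.
induction n as [|n IH].
- rewrite series_eq_0_0. simpl. ring.
- assert (h := Tf_series_rel_n n). rewrite IH, Tf_series_rho in h. assert (h2 := Rf_series_rel_n n).
  assert (hn0 := pos_INR n). rewrite S_INR, fact_S.
  apply (Rmult_eq_reg_l (16 * (INR n + 1) ^ 6)).
  (* Multiplied by -2 n! (n+1)^3, the well-poised recurrence becomes that of the double sum, with 6
     n! [rho n] in place of the value at l = n + 1. *)
  + transitivity (-2 * INR (fact n) * (INR n + 1) ^ 3 * (16 * (INR n + 1) ^ 4 * Rf_series (S n) 0 (S n))); [|ring].
    replace (16 * (INR n + 1) ^ 4 * Rf_series (S n) 0 (S n)) with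
      (- 3 * cR (INR n) * rho n - 256 * (2 * INR n + 1) ^ 4 * Rf_series n 0 n) by lra.
    lra.
  + apply Rmult_integral_contrapositive_currified; [lra|apply pow_nonzero; lra].
Qed.

(** The first factor of [cA] equals m + 1 here, so the recurrence can be solved for the term of
    largest m. *)
Lemma cA_neq_0 (n m l : nat) : n = (S m + l)%nat -> cA (INR n) (INR l + 1) <> 0.
Proof.
intros hn. assert (hm := pos_INR m). assert (hl := pos_INR l).
assert (E : INR n = INR m + INR l + 1) by (rewrite hn, plus_INR, S_INR; ring).
unfold cA. apply Ropp_neq_0_compat.
repeat apply Rmult_integral_contrapositive_currified; lra.
Qed.

Lemma series_eq (m : nat) : forall n l, n = (m + l)%nat ->
  dseries 2 1 (Tf n (INR l)) = - 2 * INR (fact n) * Rf_series n m l.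
Proof.
induction m as [m IH] using lt_wf_ind. intros n l hn.
destruct m as [|[|m]].
- simpl in hn. subst. apply series_eq_m0.
- assert (hn' : n = S l) by lia.
  assert (h := Tf_series_rel_m n (INR l + 1) ltac:(lia) ltac:(generalize (pos_INR l); lra)).
  assert (h2 := Rf_series_rel_m0 n l hn').
  replace (INR l + 1 - 1) with (INR l) in h by ring.
  (* For m = 1 the middle parameter l + 1 is n, so the outer one is n + 1, whose series is known
     from [rho]. *)
  assert (e : INR l + 1 = INR n) by (rewrite hn', S_INR; reflexivity).
  rewrite e, Tf_series_rho, series_eq_m0 in h. rewrite e in h2. rewrite <- hn' in h2.
  apply (Rmult_eq_reg_l (cA (INR n) (INR n))); [|rewrite <- e at 2; apply (cA_neq_0 n 0 l); lia].
  transitivity (-2 * INR (fact n) * (cA (INR n) (INR n) * Rf_series n 1 l)); [|ring].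
  replace (cA (INR n) (INR n) * Rf_series n 1 l) with
    (3 * cC (INR n) (INR n) * rho n - cB (INR n) (INR n) * Rf_series n 0 n) by lra.
  lra.
- assert (h := Tf_series_rel_m n (INR l + 1) ltac:(lia) ltac:(generalize (pos_INR l); lra)).
  assert (h2 := Rf_series_rel_m n m l ltac:(lia)).
  replace (INR l + 1 - 1) with (INR l) in h by ring.
  assert (i1 := IH (S m) ltac:(lia) n (S l) ltac:(lia)). rewrite S_INR in i1.
  assert (i2 := IH m ltac:(lia) n (S (S l)) ltac:(lia)). rewrite !S_INR in i2.
  rewrite i1, i2 in h.
  apply (Rmult_eq_reg_l (cA (INR n) (INR l + 1))); [|apply (cA_neq_0 n (S m) l); lia].
  transitivity (-2 * INR (fact n) * (cA (INR n) (INR l + 1) * Rf_series n (S (S m)) l)); [|ring].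
  replace (cA (INR n) (INR l + 1) * Rf_series n (S (S m)) l) with
    (- cB (INR n) (INR l + 1) * Rf_series n (S m) (S l) - cC (INR n) (INR l + 1) * Rf_series n m (S (S l))) by lra.
  lra.
Qed.

(** * Identification with the rational functions of the theorem *)

Lemma Rnm_Rf (n m l : nat) (t : R) : n = (m + l)%nat -> 0 < t -> Rnm n m t = Rf n m l t.
Proof.
intros hn ht. unfold Rnm, Rf, kap.
replace (2 * n - m)%nat with (n + l)%nat by lia. replace (n + 1)%nat with (S n) by lia.
replace (n + l + 1)%nat with (S n + l)%nat by lia. rewrite (poch_add t (S n) l).
assert (En : INR n = INR m + INR l) by (rewrite hn, plus_INR; reflexivity).
replace (poch (t + INR n + 1) n) with (poch (t + INR n + 1) (l + m)) by (f_equal; lia).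
rewrite (poch_add (t + INR n + 1) l m), S_INR.
replace (t - 2 * INR n + INR m) with (t - INR n - INR l) by (rewrite En; ring).
replace (t + INR n + 1 + INR l) with (t + INR n + INR l + 1) by ring.
replace (t + (INR n + 1)) with (t + INR n + 1) by ring.
assert (p1 := poch_pos t (S n) ht).
assert (p2 := poch_pos (t + INR n + 1) l ltac:(generalize (pos_INR n); lra)).
assert (f1 := INR_fact_lt_0 m). assert (f2 := INR_fact_lt_0 (n + l)).
field. repeat split; lra.
Qed.

(** Splitting [poch (t - n) (n + l)] and [poch t (n + l + 1)] shows a common factor [poch t l]; once
    it is cancelled, l is only a shift. *)
Lemma Rtnm_Tf (n m l : nat) (t : R) : n = (m + l)%nat -> 0 < t ->
  Rtnm n m t = / INR (fact n) * Tf n (INR l) t.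
Proof.
intros hn ht. unfold Rtnm, Tf, Qf.
replace (2 * n - m)%nat with (n + l)%nat by lia. replace (n + 1)%nat with (S n) by lia.
replace (n + l + 1)%nat with (l + S n)%nat by lia. rewrite (poch_add t l (S n)).
rewrite (poch_add (t - INR n) n l). replace (t - INR n + INR n) with t by ring.
assert (p1 := poch_pos t (S n) ht). assert (p2 := poch_pos t l ht).
assert (p3 := poch_pos (t + INR l) (S n) ltac:(generalize (pos_INR l); lra)).
assert (f1 := INR_fact_lt_0 n).
rewrite (sum_eq _ (fun j => Tt n (INR l) j t * / INR (fact n) ^ 2)).
- rewrite <- scal_sum. field. repeat split; lra.
- intros j hj. unfold Tt. rewrite bc_C by exact hj.
  replace (INR l + INR j + 1) with (INR (l + j) + 1) by (rewrite plus_INR; ring).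
  rewrite poch_fact. replace (l + j + n)%nat with (n + l + j)%nat by lia.
  unfold Binomial.C. replace (n + l + j - n)%nat with (l + j)%nat by lia.
  field. repeat split; apply INR_fact_neq_0.
Qed.

(** From n - m + 1 to n both [poch (t - n) m] and [poch (t - n - l) (n + l)] vanish, so the zero is
    double. *)
Lemma Derive_Rf_0 (n m l i : nat) : n = (m + l)%nat -> (i < m)%nat ->
  Derive (Rf n m l) (INR (l + 1 + i)) = 0.
Proof.
intros hn hi. assert (hp : 0 < INR (l + 1 + i)) by (apply lt_0_INR; lia).
(* The dummy [- 0] gives both vanishing factors the form t - a - b of [ex_derive_poch_minus]. *)
rewrite (Derive_ext (Rf n m l) (fun t => poch (t - INR n - 0) m * poch (t - INR n - INR l) (n + l)
  * (kap n m l * (t + INR n / 2) * poch (t + (INR n + INR l + 1)) m * poch (t + (INR n + 1)) (n + l) * / poch t (S n) ^ 4))).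
2:{ intros t. unfold Rf. rewrite Rminus_0_r, <- !Rplus_assoc. ring. }
apply (Derive_two_zeros (fun t => poch (t - INR n - 0) m) (fun t => poch (t - INR n - INR l) (n + l))
  (fun t => kap n m l * (t + INR n / 2) * poch (t + (INR n + INR l + 1)) m * poch (t + (INR n + 1)) (n + l) * / poch t (S n) ^ 4)).
- apply ex_derive_poch_minus.
- apply ex_derive_poch_minus.
- refine (symbol_ex_derive _ _ _ _ hp). generalize (kap n m l); intros c.
  repeat apply symbol_mult; try apply symbol_poch; try apply symbol_inv_poch_4; try apply symbol_shift. apply symbol_const.
- replace (INR (l + 1 + i) - INR n - 0) with (- INR (m - 1 - i)).
  + apply poch_neg_0. lia.
  + rewrite !minus_INR by lia. rewrite hn, !plus_INR. simpl. ring.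
- replace (INR (l + 1 + i) - INR n - INR l) with (- INR (n - 1 - i)).
  + apply poch_neg_0. lia.
  + rewrite !minus_INR by lia. rewrite hn, !plus_INR. simpl. ring.
Qed.

(** Moves the start of the sum, one vanishing term at a time; i = m leads from n - m + 1 to n +
    1. *)
Lemma Rf_series_start (n m l i : nat) : n = (m + l)%nat -> (i <= m)%nat ->
  dseries 1 (l + 1) (Rf n m l) = dseries 1 (l + 1 + i) (Rf n m l).
Proof.
intros hn hi. induction i as [|i IH]; [rewrite Nat.add_0_r; reflexivity|].
rewrite IH, (dseries_S 1 _ 3) by (try apply symbol_Rf; lia).
change (Derive_n ?f 1 ?x) with (Derive f x). rewrite Derive_Rf_0 by lia.
rewrite Rplus_0_l. f_equal. lia.
Qed.

Theorem theorem1 (n m : nat) (hmn : (m <= n)%nat) :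
  ex_series (fun k => Derive (Rnm n m) (INR (k + (n - m + 1)))) /\
  ex_series (fun k => Derive_n (Rtnm n m) 2 (INR (k + 1))) /\
  - (1 / 3) * Series (fun k => Derive (Rnm n m) (INR (k + (n - m + 1))))
  = (1 / 6) * Series (fun k => Derive_n (Rtnm n m) 2 (INR (k + 1))).
Proof.
set (l := (n - m)%nat). assert (hn : n = (m + l)%nat) by (unfold l; lia). clearbody l.
assert (hR : forall t, 0 < t -> Rf n m l t = Rnm n m t) by (intros; symmetry; apply Rnm_Rf; assumption).
assert (hT : forall t, 0 < t -> / INR (fact n) * Tf n (INR l) t = Rtnm n m t)
  by (intros; symmetry; apply Rtnm_Tf; assumption).
assert (sR : symbol 1 3 (Rnm n m)) by (apply (symbol_ext 1 3 _ _ hR), symbol_Rf, hn).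
assert (sT : symbol 2 2 (Rtnm n m)) by (apply (symbol_ext 2 2 _ _ hT), symbol_scal, symbol_Tf, pos_INR).
split; [apply (symbol_ex_series 1 3 (Rnm n m)); [exact sR|lia|lia]|].
split; [apply (symbol_ex_series 2 2 (Rtnm n m)); [exact sT|lia|lia]|].
(* The functions agree for t > 0, hence near every point of summation, so their derivatives agree
   there too. *)
transitivity (- (1 / 3) * dseries 1 (l + 1) (Rf n m l)).
{ f_equal. apply Series_ext. intros k. apply Derive_ext_loc, eq_pos_locally.
  - intros t ht; symmetry; apply hR, ht.
  - apply lt_0_INR; lia. }
transitivity (1 / 6 * (/ INR (fact n) * dseries 2 1 (Tf n (INR l)))).
- rewrite (Rf_series_start n m l m hn (le_n _)), (series_eq m n l hn).
  unfold Rf_series. replace (l + 1 + m)%nat with (n + 1)%nat by lia.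
  field. apply INR_fact_neq_0.
- f_equal. unfold dseries. rewrite <- Series_scal_l. apply Series_ext. intros k.
  rewrite <- Derive_n_scal_l. apply Derive_n_ext_loc, eq_pos_locally; [exact hT|apply lt_0_INR; lia].
Qed.
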